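(* Let $n\ge 1$ and let $f:\mathbb{R}^n/\mathbb{Z}^n\to\mathbb{R}^n/\mathbb{Z}^n$ be a linear map of the $n$-torus, i.e. a map of the form $x\mapsto Ax \bmod \mathbb{Z}^n$ for some $n\times n$ matrix $A$ with integer entries. Then $\mathrm{HausLip}(\mathbb{R}^n/\mathbb{Z}^n,f)=h(f)$, where $h(f)$ is the topological entropy of $f$. In other words, for each $\epsilon>0$ there is a metric $d$ on $\mathbb{R}^n/\mathbb{Z}^n$ compatible with the topology such that $$\mathrm{HD}_d(\mathbb{R}^n/\mathbb{Z}^n)\cdot\log^+\mathrm{Lip}_d(f) < h(f)+\epsilon.$$
   Context: Let $X$ be a compact metrizable space and $f:X\to X$ a continuous map. A metric $d:X\times X\to[0,\infty)$ is compatible if the topology it induces coincides with the topology of $X$; $\mathcal{D}(X)$ denotes the set of all compatible metrics on $X$. For $d\in\mathcal{D}(X)$, the Lipschitz constant is $\mathrm{Lip}_d(f)=\sup_{0<d(x,y)} \frac{d(f(x),f(y))}{d(x,y)}\in[0,\infty]$ (supremum taken in $[0,\infty]$; the value $\infty$ means $f$ is not Lipschitz with respect to $d$). $\mathrm{HD}_d(X)\in[0,\infty]$ is the usual Hausdorff dimension of the metric space $(X,d)$. We write $\log^+(y)=\max(\log y,0)$, with $\log^+ 0=0$ and $\log^+\infty=\infty$. The HausLip constant of the system $(X,f)$ is $$\mathrm{HausLip}(X,f)=\inf_{d\in\mathcal{D}(X)} \mathrm{HD}_d(X)\cdot\log^+\mathrm{Lip}_d(f)\in[0,\infty],$$ with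 the convention $0\cdot\infty=\infty\cdot 0=\infty$ (so metrics for which $f$ is not Lipschitz or $X$ has infinite Hausdorff dimension are effectively ignored). *)

(* Defs.v *)
From HB Require Import structures.
From mathcomp Require Import all_boot all_order all_algebra.
From mathcomp Require Import all_classical all_reals all_analysis.
From mathcomp Require Import generic_quotient ring_quotient finmap.

Set Implicit Arguments.
Unset Strict Implicit.
Unset Printing Implicit Defensive.

Import Order.TTheory GRing.Theory Num.Theory.
Import numFieldNormedType.Exports.

Local Open Scope quotient_scope.
Local Open Scope classical_set_scope.
Local Open Scope ring_scope.

Definition is_metric (R : realType) (X : Type) (d : X -> X -> R) : Prop :=
  [/\ forall x y, 0 <= d x y,
      forall x y, d x y = 0 <-> x = y,
      forall x y, d x y = d y x &
      forall x y z, d x z <= d x y + d y z].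

Definition compatible_metric (R : realType) (X : topologicalType)
    (d : X -> X -> R) : Prop :=
  is_metric d /\
  forall A : set X,
    open A <-> forall x, A x ->
      exists2 e : R, 0 < e & [set y | d x y < e] `<=` A.

(* The supremum is taken in [0, +oo], so 0 is adjoined to the set: the
   supremum of the empty set is 0. The same applies to [diam]. *)
Definition Lip (R : realType) (X : Type) (d : X -> X -> R) (f : X -> X) :
    \bar R :=
  ereal_sup (0%E |`
    [set (d (f xy.1) (f xy.2) / d xy.1 xy.2)%:E | xy in
      [set xy : X * X | 0 < d xy.1 xy.2]]).

Definition diam (R : realType) (X : Type) (d : X -> X -> R) (A : set X) :
    \bar R :=
  ereal_sup (0%E |` [set (d xy.1 xy.2)%:E | xy in A `*` A]).

(* [diam A] to the power [s], with the conventions of the Hausdorff measure: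
   0 for the empty set, and 0 ^ 0 = 1 (so that the 0-dimensional measure is
   the counting measure). *)
Definition diam_pow (R : realType) (X : Type) (d : X -> X -> R) (s : R)
    (A : set X) : \bar R :=
  if A == set0 then 0%E else (diam d A `^ s)%E.

Definition hausdorff_premeasure (R : realType) (X : Type) (d : X -> X -> R)
    (s delta : R) (E : set X) : \bar R :=
  ereal_inf [set (\sum_(0 <= i <oo) diam_pow d s (U i))%E | U in
    [set U : nat -> set X | E `<=` \bigcup_i U i /\
       forall i, (diam d (U i) <= delta%:E)%E]].

(* The premeasures increase as [delta] decreases to 0: their limit is their
   supremum. *)
Definition hausdorff_measure (R : realType) (X : Type) (d : X -> X -> R)
    (s : R) (E : set X) : \bar R :=
  ereal_sup [set hausdorff_premeasure d s delta E | delta in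
    [set delta : R | 0 < delta]].

Definition HD (R : realType) (X : Type) (d : X -> X -> R) : \bar R :=
  ereal_inf [set s%:E | s in
    [set s : R | 0 <= s /\ hausdorff_measure d s [set: X] = 0%E]].

Definition logp (R : realType) (y : \bar R) : \bar R := maxe (lne y) 0%E.

(* Product in [0, +oo] with 0 * oo = oo * 0 = oo, unlike [mule], for which
   these products are 0. *)
Definition mul_infty (R : realType) (a b : \bar R) : \bar R :=
  if (a == +oo%E) || (b == +oo%E) then +oo%E else (a * b)%E.

Definition HausLip (R : realType) (X : topologicalType) (f : X -> X) :
    \bar R :=
  ereal_inf [set mul_infty (HD d) (logp (Lip d f)) | d in
    [set d : X -> X -> R | compatible_metric d]].

(* Topological entropy of Adler, Konheim and McAndrew. *)

Definition open_cover (X : topologicalType) (U : set (set X)) : Prop :=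
  U `<=` open /\ \bigcup_(A in U) A = [set: X].

(* Smallest cardinality of a finite subcover. *)
Definition cover_number (R : realType) (X : Type) (U : set (set X)) : \bar R :=
  ereal_inf [set (#|` F|%:R)%:E | F in
    [set F : {fset (set X)} |
      [set` F] `<=` U /\ \bigcup_(A in [set` F]) A = [set: X]]].

(* The join of the preimages of the cover [U] by [f ^ i], [i < m]. *)
Definition iterated_join (X : Type) (f : X -> X) (U : set (set X)) (m : nat) :
    set (set X) :=
  [set \bigcap_(i in `I_m) (iter i f @^-1` A i) | A in
    [set A : nat -> set X | forall i, U (A i)]].

Definition cover_entropy (R : realType) (X : Type) (f : X -> X)
    (U : set (set X)) : \bar R :=
  limn (fun m : nat =>
    ((m%:R^-1)%:E * lne (cover_number R (iterated_join f U m)))%E).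

Definition topological_entropy (R : realType) (X : topologicalType)
    (f : X -> X) : \bar R :=
  ereal_sup [set cover_entropy R f U | U in
    [set U : set (set X) | open_cover U]].

Definition integer_vector (R : realType) (n : nat) (x : 'cV[R]_n) : bool :=
  [forall i, x i 0 \is a Num.int].

Lemma integer_vector_zmod_closed (R : realType) (n : nat) :
  zmod_closed (@integer_vector R n).
Proof.
split=> [|x y /forallP hx /forallP hy]; apply/forallP => i; rewrite !mxE.
  exact: rpred0.
exact: rpredB.
Qed.

HB.instance Definition _ (R : realType) (n : nat) :=
  GRing.isZmodClosed.Build 'cV[R]_n (@integer_vector R n)
    (@integer_vector_zmod_closed R n).

Definition Zn (R : realType) (n : nat) : zmodClosed 'cV[R]_n :=
  GRing.ZmodClosed.clone 'cV[R]_n (@integer_vector R n) _.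

(* R^n / Z^n: the quotient of the group R^n by the subgroup Z^n, with the
   quotient topology. *)
Definition torus (R : realType) (n : nat) : topologicalType :=
  quotient_topology (Quotient.quot (Zn R n)).

Definition torus_proj (R : realType) (n : nat) (x : 'cV[R]_n) : torus R n :=
  \pi_(Quotient.quot (Zn R n)) x.

Definition torus_linear (R : realType) (n : nat)
    (f : torus R n -> torus R n) : Prop :=
  exists A : 'M[int]_n, forall x : 'cV[R]_n,
    f (torus_proj x) = torus_proj (map_mx intr A *m x).

Lemma torus_projP (R : realType) (n : nat) (x y : 'cV[R]_n) :
  torus_proj x = torus_proj y <-> forall i, x i 0 - y i 0 \is a Num.int.
Proof.
have E := Quotient.idealrBE (Zn R n) x y.
split=> [h i|h].
  have : x - y \in Zn R n by rewrite E; apply/eqP.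
  by move=> /forallP/(_ i); rewrite !mxE.
suff /eqP : x == y %[mod (Quotient.quot (Zn R n))] by [].
by rewrite -E; apply/forallP => i; rewrite !mxE.
Qed.

Lemma torus_linear_exists (R : realType) (n : nat) (A : 'M[int]_n) :
  exists f : torus R n -> torus R n, forall x : 'cV[R]_n,
    f (torus_proj x) = torus_proj (map_mx intr A *m x).
Proof.
pose r (t : torus R n) : 'cV[R]_n :=
  repr (t : Quotient.quot (Zn R n)).
have rK t : torus_proj (r t) = t by exact: reprK.
exists (fun t => torus_proj (map_mx intr A *m r t)) => x.
have /torus_projP h := rK (torus_proj x).
apply/torus_projP => i; rewrite !mxE -sumrB rpred_sum// => j _.
by rewrite -mulrBr mxE rpredM// ?h// intr_int.
Qed.

(* Main.v *)
(** For a compatible metric [d] with [H^s(X) = 0] and an [L]-Lipschitz map,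
    [L > 1], cover [X] by small open sets [E_i] with small total
    [\sum_i diam(E_i)^s]; the orbit of [E_i] stays small for a time [n_i] with
    [L^(- n_i) ~ diam E_i], so that [\sum_i exp(- s ln L n_i) <= 1], and
    concatenating these orbit blocks bounds the entropy by [s ln L].

    Conversely, triangularize the matrix [A] over the complex numbers,
    [V A = T V], with moduli [rho_i] of the diagonal entries of [T] decreasing.
    With [a_i = ln (max 1 rho_i) + b], the snowflaked function
    [D x = max_i |(V x)_i|^(b / a_i)] satisfies [D (A x) <= e^b D x] where
    [D x <= 1], and the unit cube is covered by about [r^(- \sum_i a_i / b)]
    sets of [D]-diameter [r]: the induced metric on the torus has
    dimension times log-Lipschitz constant at most
    [\sum_i a_i = \sum_i ln (max 1 rho_i) + n b]. Finally
    [\sum_i ln (max 1 rho_i)] is at most the entropy: in triangular coordinates,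
    a grid with about [rho_i^m] steps in the [i]-th coordinate is separated
    after [m] iterations. *)
Require Import Defs.
From HB Require Import structures.
From mathcomp Require Import all_boot all_order all_algebra.
From mathcomp Require Import all_classical all_reals all_analysis.
From mathcomp Require Import generic_quotient ring_quotient finmap complex.
From mathcomp Require Import ring lra.

Set Implicit Arguments.
Unset Strict Implicit.
Unset Printing Implicit Defensive.

Import Order.TTheory GRing.Theory Num.Theory.
Import numFieldNormedType.Exports.
Import Normc.

Local Open Scope classical_set_scope.
Local Open Scope ring_scope.

(** * Entropy is at most Hausdorff dimension times log Lipschitz constant *)

(** Fekete's lemma: dividing [n] by a fixed [p] with remainder squeezes [a n / n] between the
    infimum of the quotients over positive indices and [a p / p] plus a vanishing term. *)
Lemma subadditive_is_cvgn (R : realType) (a : R^nat) :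
  (forall n, 0 <= a n) -> (forall m n, a (m + n)%N <= a m + a n) ->
  cvgn (fun n => n%:R^-1 * a n).
Proof.
move=> a0 aD.
pose S := [set n%:R^-1 * a n | n in [set n | (0 < n)%N]].
have S0 : has_inf S.
  split; first by exists (1%:R^-1 * a 1%N), 1%N.
  by exists 0 => _ [n _ <-]; rewrite mulr_ge0.
apply/cvg_ex; exists (inf S); apply/cvgrPdist_le => e e0.
have e20 : 0 < e / 2 by rewrite divr_gt0.
have [_ [p p0 <-] pe] := inf_adherent e20 S0.
(* [M] dominates [a r] for every remainder [r < p]. *)
pose M := \sum_(r < p) a r.
have M0 : 0 <= M by rewrite sumr_ge0.
have aM q r : (r < p)%N -> a (q * p + r)%N <= q%:R * a p + M.
  move=> rp; elim: q => [|q IH].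
    rewrite mul0n add0n mul0r add0r /M (bigD1 (Ordinal rp))//= lerDl.
    by rewrite sumr_ge0.
  rewrite mulSn -addnA; apply: (le_trans (aD _ _)).
  by rewrite -natr1 mulrDl mul1r addrAC [leRHS]addrC lerD2l.
near=> n.
have n0 : (0 < n)%N by near: n; exact: nbhs_infty_gt.
have nR0 : 0 < n%:R :> R by rewrite ltr0n.
have pR0 : 0 < p%:R :> R by rewrite ltr0n.
have linf : inf S <= n%:R^-1 * a n by apply: ge_inf; [exact: S0.2|exists n].
rewrite distrC ger0_norm ?subr_ge0// lerBlDl.
rewrite [X in _ * a X](divn_eq n p).
apply: (@le_trans _ _ (n%:R^-1 * ((n %/ p)%:R * a p + M))).
  by rewrite ler_wpM2l ?invr_ge0 ?ler0n// aM// ltn_mod.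
rewrite mulrDr (splitr e) addrA; apply: lerD.
  apply: le_trans (ltW pe).
  rewrite mulrCA mulrA ler_wpM2r// ler_pdivrMr// -[leRHS]mulrC ler_pdivlMr//.
  by rewrite -natrM ler_nat leq_divM.
rewrite mulrC ler_pdivrMr// -ler_pdivrMl//.
by near: n; apply: nbhs_infty_ger.
Unshelve. all: by end_near. Qed.

(** * Subcovers of iterated joins and their cardinalities *)

Section iterated_join.
Variables (R : realType) (X : Type) (f : X -> X) (U : set (set X)).
Local Notation join := (iterated_join f U).

Definition finite_subcover (V : set (set X)) (F : {fset (set X)}) : Prop :=
  [set` F] `<=` V /\ \bigcup_(A in [set` F]) A = [set: X].

(** Duplicates only lower the cardinality, so subcovers can be built and counted as sequences. *)
Lemma finite_subcover_seq (V : set (set X)) (s : seq (set X)) :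
  (forall A, A \in s -> V A) -> (forall x, exists2 A, A \in s & A x) ->
  exists2 F, finite_subcover V F & (#|` F| <= size s)%N.
Proof.
move=> sV sX; exists [fset A in s]%fset; last first.
  by rewrite card_fseq size_undup.
split=> [A|]; first by rewrite /= inE; exact: sV.
by apply/seteqP; split=> // x _; have [A As Ax] := sX x; exists A;
  rewrite //= inE.
Qed.

Lemma cover_number_le (V : set (set X)) F :
  finite_subcover V F -> (cover_number R V <= (#|` F|%:R)%:E)%E.
Proof. by move=> FV; apply: ereal_inf_lbound; exists F. Qed.

(** A nonempty set of natural numbers has a least element, so the infimum is a minimum. *)
Lemma cover_number_attained (V : set (set X)) F : finite_subcover V F ->
  exists2 G, finite_subcover V G & cover_number R V = (#|` G|%:R)%:E.
Proof.
move=> FV.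
have ex : exists k, `[< exists2 G, finite_subcover V G & #|` G| = k >].
  by exists #|` F|; apply/asboolP; exists F.
case: (ex_minnP ex) => k /asboolP[G GV Gk] kmin; exists G => //.
apply/eqP; rewrite eq_le cover_number_le//=.
apply: le_ereal_inf_tmp => _ [H HV <-]; rewrite lee_fin ler_nat Gk.
by apply: kmin; apply/asboolP; exists H.
Qed.

Lemma iterated_joinD m n A B :
  join m A -> join n B -> join (m + n) (A `&` iter m f @^-1` B).
Proof.
move=> [A' A'U <-] [B' B'U <-].
exists (fun i => if (i < m)%N then A' i else B' (i - m)%N).
  by move=> i /=; case: ifP.
apply/seteqP; split=> x /=.
  move=> h; split=> i /= im.
    by have := h i; rewrite /= im; apply; apply: ltn_addr.
  have := h (i + m)%N; rewrite /= [X in if X then _ else _]ltnNge leq_addl/=.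
  by rewrite addnK iterD; apply; rewrite addnC ltn_add2l.
move=> [h1 h2] i /= imn; case: ltnP => im; first exact: h1.
have := h2 (i - m)%N; rewrite /= -iterD subnK//; apply.
by rewrite ltn_subLR.
Qed.

Lemma iterated_join_prefix m n A : (m <= n)%N -> join n A ->
  exists2 B, join m B & A `<=` B.
Proof.
move=> mn [A' A'U <-]; exists (\bigcap_(i in `I_m) (iter i f @^-1` A' i)).
  by exists A'.
by move=> x h i /= im; apply: h; exact: leq_trans mn.
Qed.

Lemma finite_subcoverD m n F G : finite_subcover (join m) F ->
  finite_subcover (join n) G ->
  exists2 H, finite_subcover (join (m + n)) H & (#|` H| <= #|` F| * #|` G|)%N.
Proof.
move=> [Fm FX] [Gn GX].
pose s := [seq A `&` iter m f @^-1` B | A <- enum_fset F, B <- enum_fset G].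
have [||H HV Hs] := @finite_subcover_seq (join (m + n)) s.
- move=> _ /allpairsP[[A B] /= [AF BG ->]].
  by apply: iterated_joinD; [exact: Fm|exact: Gn].
- move=> x.
  have : [set: X] x by []. rewrite -FX => -[A /= AF Ax].
  have : [set: X] (iter m f x) by []. rewrite -GX => -[B /= BG Bx].
  by exists (A `&` iter m f @^-1` B) => //; apply/allpairsP; exists (A, B).
- by exists H => //; apply: leq_trans Hs _; rewrite size_allpairs.
Qed.

Lemma iterated_join0 : (exists A, U A) -> join 0 [set: X].
Proof.
by move=> [A UA]; exists (fun=> A) => //; rewrite II0 bigcap_set0.
Qed.

Lemma iterated_join1 A : U A -> join 1 A.
Proof.
move=> UA; exists (fun=> A) => //; rewrite II1 bigcap_set1.
by apply/seteqP; split.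
Qed.

Lemma finite_subcover_join (x0 : X) F m : finite_subcover U F ->
  exists G, finite_subcover (join m) G.
Proof.
move=> [FU FX]; have : [set: X] x0 by []. rewrite -FX => -[A0 A0F _].
elim: m => [|m [G Gm]].
  exists [fset [set: X]]%fset; split=> [A|].
    by rewrite /= inE => /eqP ->; apply: iterated_join0; exists A0; exact: FU.
  by apply/seteqP; split=> // x _; exists setT; rewrite //= inE.
have F1 : finite_subcover (join 1) F.
  by split=> // A /FU; exact: iterated_join1.
by have [H HV _] := finite_subcoverD F1 Gm; exists H.
Qed.

(* Concatenating orbit blocks of the lengths [p.2], the weights
   [expR (- lam * p.2)] of total mass at most 1 multiply like probabilities. *)
Lemma cover_number_concat (lam : R) (M : nat) (r : seq (set X * nat)) :
  0 <= lam -> (exists A, U A) ->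
  (forall p, p \in r -> [/\ join p.2 p.1, (0 < p.2)%N & (p.2 <= M)%N]) ->
  (forall x, exists2 p, p \in r & p.1 x) ->
  \sum_(p <- r) expR (- lam * p.2%:R) <= 1 ->
  forall m, exists2 F, finite_subcover (join m) F &
    #|` F|%:R <= expR (lam * M%:R) * expR (lam * m%:R).
Proof.
move=> lam0 U0 rP rX r1 m.
suff [s [sm sX ss]] : exists s, [/\ forall A, A \in s -> join m A,
    forall x, exists2 A, A \in s & A x &
    (size s)%:R <= expR (lam * M%:R) * expR (lam * m%:R)].
  have [F FV Fs] := finite_subcover_seq sm sX; exists F => //.
  by apply: le_trans ss; rewrite ler_nat.
elim/ltn_ind: m => m IH.
(* Inner induction on the list of blocks: the points lying in a sublist of blocks need only the
   corresponding share of the mass. The hypothesis for smaller [m] does not mention the list and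
   stays available. *)
suff [s [sm sX ss]] : exists s, [/\ forall A, A \in s -> join m A,
    forall x, (exists2 p, p \in r & p.1 x) -> exists2 A, A \in s & A x &
    (size s)%:R <= expR (lam * M%:R) * expR (lam * m%:R) *
      \sum_(p <- r) expR (- lam * p.2%:R)].
  exists s; split=> // [x|]; first exact: sX.
  by apply: (le_trans ss); rewrite ler_piMr// mulr_ge0 ?expR_ge0.
elim: r {r1 rX} rP => [|[E n] r IHr] rP.
  by exists [::]; split=> // [x [p]//|]; rewrite big_nil mulr0.
have [p pr|s [sm sX ss]] := IHr; first by apply: rP; rewrite inE pr orbT.
have /= [jE n0 nM] := rP _ (mem_head _ _).
suff [t [tm tX ts]] : exists t, [/\ forall A, A \in t -> join m A,
    forall x, E x -> exists2 A, A \in t & A x &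
    (size t)%:R <= expR (lam * M%:R) * expR (lam * m%:R) *
       expR (- lam * n%:R)].
  exists (t ++ s); split.
  - by move=> A; rewrite mem_cat => /orP[/tm|/sm].
  - move=> x [p]; rewrite inE => /predU1P[->/tX[A At Ax]|pr px].
      by exists A; rewrite // mem_cat At.
    have [|A As Ax] := sX x; first by exists p.
    by exists A; rewrite // mem_cat As orbT.
  - by rewrite size_cat natrD big_cons mulrDr lerD.
(* A block of length at least [m] is cut to its first [m] steps: one set suffices, and the factor
   [expR (lam * M%:R)] pays for it since [n <= M]. *)
have [mn|nm] := leqP m n.
  have [B jB EB] := iterated_join_prefix mn jE.
  exists [:: B]; split.
  - by move=> A; rewrite inE => /eqP ->.
  - by move=> x /EB Bx; exists B; rewrite ?inE.
  - have -> : (size [:: B])%:R = expR 0 :> R by rewrite expR0.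
    rewrite -!expRD ler_expR -!mulrDr mulNr -mulrBr.
    by rewrite mulr_ge0// subr_ge0 -natrD ler_nat (leq_trans nM)// leq_addr.
(* A shorter block is followed by a cover for the remaining [m - n] steps. *)
have [|s' [s'm s'X s's]] := IH (m - n)%N;
  first by rewrite ltn_subrL n0 (leq_trans n0 (ltnW nm)).
exists [seq E `&` iter n f @^-1` B | B <- s']; split.
- move=> _ /mapP[B Bs ->]; rewrite -(subnKC (ltnW nm)).
  by apply: iterated_joinD => //; exact: s'm.
- move=> x Ex; have [B Bs Bx] := s'X (iter n f x).
  by exists (E `&` iter n f @^-1` B) => //; apply: map_f.
- rewrite size_map (le_trans s's)// -mulrA ler_wpM2l ?expR_ge0//.
  by rewrite -expRD ler_expR natrB ?(ltnW nm)// mulrBr mulNr.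
Qed.

End iterated_join.

(** * The entropy of one cover as a real limit *)

Section cover_entropy.
Variables (R : realType) (X : Type) (f : X -> X) (U : set (set X)) (x0 : X).
Variables (F0 : {fset (set X)}) (F0U : finite_subcover U F0).
Local Notation join := (iterated_join f U).

(** Finite subcovers make the cover numbers positive integers, with subadditive logarithms by
    [finite_subcoverD]; hence the limit exists in the reals and agrees with the extended one. *)
Lemma cover_entropyE : exists c : nat -> nat,
  [/\ forall m, exists2 G, finite_subcover (join m) G & #|` G| = c m,
      forall m G, finite_subcover (join m) G -> (c m <= #|` G|)%N,
      forall m, (0 < c m)%N,
      cvgn (fun m => m%:R^-1 * ln (c m)%:R : R) &
      cover_entropy R f U = (limn (fun m => m%:R^-1 * ln (c m)%:R : R))%:E].
Proof.
have /choice[c cP] : forall m, exists k : nat,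
    (exists2 G, finite_subcover (join m) G & #|` G| = k) /\
    cover_number R (join m) = (k%:R)%:E.
  move=> m; have [G GV] := finite_subcover_join f x0 m F0U.
  by have [H HV HE] := cover_number_attained R GV; exists #|` H|; split=> //;
    exists H.
have cmin m G : finite_subcover (join m) G -> (c m <= #|` G|)%N.
  by move=> /(cover_number_le R); rewrite (cP m).2 lee_fin ler_nat.
have c0 m : (0 < c m)%N.
  have [[G [_ GX] <-] _] := cP m.
  have : [set: X] x0 by []. rewrite -GX => -[A /= AG _].
  by rewrite cardfs_gt0; apply/fset0Pn; exists A.
have cR0 m : 0 < (c m)%:R :> R by rewrite ltr0n.
have cvgc : cvgn (fun m => m%:R^-1 * ln (c m)%:R : R).
  apply: (subadditive_is_cvgn (a := fun m => ln (c m)%:R)) => [m|m n].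
    by rewrite ln_ge0// ler1n.
  rewrite -lnM ?posrE// ler_ln ?posrE ?mulr_gt0// -natrM ler_nat.
  have [[G GV <-] _] := cP m; have [[H HV <-] _] := cP n.
  have [K KV KGH] := finite_subcoverD GV HV; apply: leq_trans KGH.
  exact: cmin.
exists c; split=> //; first by move=> m; case: (cP m).
rewrite /cover_entropy -EFin_lim//; congr (limn _).
by apply/funext => m; rewrite (cP m).2 lne_EFin.
Qed.

Let cvg_affine (k lam : R) :
  (fun m => m%:R^-1 * k + lam : R) @ \oo --> lam.
Proof.
rewrite -[X in _ --> X]add0r; apply: cvgD; last exact: cvg_cst.
rewrite -[X in _ --> X](mul0r k); apply: cvgMr_tmp.
apply/gtr0_cvgV0; last exact: cvgr_idn.
by near=> n; rewrite ltr0n; near: n; exact: nbhs_infty_gt.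
Unshelve. all: by end_near. Qed.

(** The factor [K] contributes [ln K / m], which tends to 0. *)
Lemma cover_entropy_le (K lam : R) : 0 < K ->
  (forall m, exists2 G, finite_subcover (join m) G &
     #|` G|%:R <= K * expR (lam * m%:R)) ->
  (cover_entropy R f U <= lam%:E)%E.
Proof.
move=> K0 GK; have [c [cP cmin c0 cvgc ->]] := cover_entropyE.
have <- : limn (fun m => m%:R^-1 * ln K + lam : R) = lam.
  by apply: cvg_lim => //; exact: cvg_affine.
rewrite lee_fin.
apply: ler_lim => //; first by apply: cvgP; exact: cvg_affine.
near=> m.
have m0 : 0 < m%:R :> R by rewrite ltr0n; near: m; exact: nbhs_infty_gt.
have [G GV Gm] := GK m.
rewrite ler_pdivrMl// mulrDr mulVKf ?gt_eqF//.
rewrite -[X in _ + X]expRK -lnM ?posrE ?expR_gt0//.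
rewrite ler_ln ?posrE ?mulr_gt0 ?expR_gt0 ?ltr0n//.
by rewrite [_%:R * lam]mulrC; apply: le_trans Gm; rewrite ler_nat; exact: cmin.
Unshelve. all: by end_near. Qed.

Lemma cover_entropy_ge (K lam : R) : 0 < K ->
  (forall m G, (0 < m)%N -> finite_subcover (join m) G ->
     K * expR (lam * m%:R) <= #|` G|%:R) ->
  (lam%:E <= cover_entropy R f U)%E.
Proof.
move=> K0 GK; have [c [cP cmin c0 cvgc ->]] := cover_entropyE.
have <- : limn (fun m => m%:R^-1 * ln K + lam : R) = lam.
  by apply: cvg_lim => //; exact: cvg_affine.
rewrite lee_fin.
apply: ler_lim => //; first by apply: cvgP; exact: cvg_affine.
near=> m.
have m0 : (0 < m)%N by near: m; exact: nbhs_infty_gt.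
have [G GV Gm] := cP m.
rewrite ler_pdivlMl ?ltr0n// mulrDr mulVKf ?gt_eqF ?ltr0n//.
rewrite -[X in _ + X]expRK -lnM ?posrE ?expR_gt0//.
rewrite ler_ln ?posrE ?mulr_gt0 ?expR_gt0 ?ltr0n//.
by rewrite [_%:R * lam]mulrC -Gm; exact: GK.
Unshelve. all: by end_near. Qed.

End cover_entropy.

(** * Slightly enlarged diameters and escape times *)

Lemma exists_pos_lbound (R : realType) (T : eqType) (s : seq T) (e : T -> R) :
  (forall x, 0 < e x) -> exists2 c, 0 < c & forall x, x \in s -> c <= e x.
Proof.
move=> e0; elim: s => [|x s [c c0 cs]]; first by exists 1.
exists (Num.min c (e x)) => [|y]; first by rewrite lt_min c0 e0.
rewrite inE => /predU1P[->|/cs ys]; first by rewrite ge_min lexx orbT.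
by rewrite ge_min ys.
Qed.

(** Serves to replace a covering set of diameter [p] by an open one, at cost [t] in the Hausdorff
    sum. For [s = 0] all powers equal 1; otherwise [q] is the [s]-th root of [p ^ s + t], capped at
    [D]. *)
Lemma powR_enlarge (R : realType) (s p D t : R) :
  0 <= s -> 0 <= p -> p < D -> 0 < t ->
  exists q, [/\ p < q, q <= D & q `^ s <= p `^ s + t].
Proof.
move=> s0 p0 pD t0; have [->|sN0] := eqVneq s 0.
  by exists D; split=> //; rewrite !powRr0 lerDl ltW.
have {sN0}s0 : 0 < s by rewrite lt_neqAle eq_sym sN0.
pose q := (p `^ s + t) `^ s^-1.
have ps0 : 0 <= p `^ s by exact: powR_ge0.
have pst0 : 0 <= p `^ s + t by rewrite addr_ge0 ?(ltW t0).
have qs : q `^ s = p `^ s + t by rewrite /q -powRrM mulVf ?gt_eqF// powRr1.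
exists (Num.min q D); split; last 1 first.
- rewrite -qs; apply: ge0_ler_powR; rewrite ?nnegrE ?le_min ?powR_ge0//=.
  + exact: ltW.
  + by rewrite (le_trans p0) ?ltW.
  + by rewrite ge_min lexx.
- rewrite lt_min pD andbT -[X in X < _]powRr1// -(@mulfV _ s) ?gt_eqF// powRrM.
  by apply: gt0_ltr_powR; rewrite ?nnegrE ?invr_gt0// ltrDl.
- by rewrite ge_min lexx orbT.
Qed.

(** Take the first [n] with [D < L ^ n * q]. It is positive because [q <= D], and
    [L ^ (- n) < q / D] raised to the power [s] is the last bound. *)
Lemma escape_time (R : realType) (L q D : R) : 1 < L -> 0 < q -> q <= D ->
  exists n : nat, [/\ (0 < n)%N, forall k, (k < n)%N -> L ^+ k * q <= D &
    forall s, 0 <= s -> expR (- (s * ln L) * n%:R) <= (q / D) `^ s].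
Proof.
move=> L1 q0 qD.
have L0 : 0 < L by exact: lt_trans L1.
have D0 : 0 < D by exact: lt_le_trans qD.
have lL : 0 < ln L by rewrite ln_gt0.
have ex : exists n, D < L ^+ n * q.
  exists (Num.truncn (ln (D / q) / ln L)).+1.
  have := truncnS_gt (ln (D / q) / ln L); rewrite ltr_pdivrMr// mulr_natl.
  rewrite -lnXn// ltr_ln ?posrE ?divr_gt0 ?exprn_gt0//.
  by rewrite ltr_pdivrMr.
case: (ex_minnP ex) => n Dn nmin; exists n; split.
- by rewrite lt0n; apply: contraTneq Dn => ->; rewrite expr0 mul1r -leNgt.
- by move=> k kn; rewrite leNgt; apply: contraTN kn => /nmin; rewrite -leqNgt.
- move=> s s0; rewrite /powR gt_eqF ?divr_gt0// ler_expR mulNr -mulrA -mulrN.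
  rewrite ler_wpM2l// mulr_natr -lnXn// -lnV ?posrE ?exprn_gt0//.
  rewrite ler_ln ?posrE ?invr_gt0 ?exprn_gt0 ?divr_gt0//.
  rewrite -[leLHS]mul1r ler_pdivrMr ?exprn_gt0// mulrC ltW//.
  by rewrite mulrA ltr_pdivlMr// mul1r.
Qed.

(** * From Hausdorff-null covers to orbit blocks *)

Section hausdorff_entropy.
Variables (R : realType) (X : topologicalType) (d : X -> X -> R) (x0 : X).
Hypotheses (dc : compatible_metric d) (cX : cover_compact [set: X]).
Let d_ge0 x y : 0 <= d x y. Proof. by have [[]] := dc. Qed.
Let dC x y : d x y = d y x. Proof. by have [[]] := dc. Qed.
Let dD x y z : d x z <= d x y + d y z. Proof. by have [[]] := dc. Qed.
Let d0 x : d x x = 0. Proof. by have [[_ h _ _] _] := dc; apply/h. Qed.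

Lemma open_metric_ball x e : open [set y | d x y < e].
Proof.
have [_ ->] := dc => y /= xy; exists (e - d x y); first by rewrite subr_gt0.
by move=> z /=; rewrite ltrBrDl; apply: le_lt_trans (dD _ _ _).
Qed.

Lemma open_cover_finite_subcover (U : set (set X)) : open_cover U ->
  exists F : {fset (set X)}, finite_subcover U F.
Proof.
move=> [Uo UX]; have [||F FU FX] := cX (D := U) (f := id) => //.
  by move=> x Xx; rewrite /cover UX.
exists F; split=> [A /FU|]; first exact: set_mem.
by apply/seteqP; split.
Qed.

(** Around each point, a ball of twice the radius [e x] fits in a member of the cover; the least of
    finitely many such radii works everywhere, by the triangle inequality. *)
Lemma lebesgue_number (U : set (set X)) : open_cover U ->
  exists2 e, 0 < e & forall x, exists2 A, U A & [set y | d x y < e] `<=` A.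
Proof.
move=> [Uo UX].
have /choice[e eP] : forall x, exists e, 0 < e /\
    exists2 A, U A & [set y | d x y < e + e] `<=` A.
  move=> x; have : [set: X] x by [].
  rewrite -UX => -[A /= UA Ax]; have [_ /(_ A)[+ _]] := dc.
  move=> /(_ (Uo _ UA))/(_ _ Ax)[e e0 eA]; exists (e / 2); split.
    by rewrite divr_gt0.
  by exists A; rewrite // -splitr.
have [||D _ DX] := cX (D := [set: X]) (f := fun x => [set y | d x y < e x]).
- by move=> x _; exact: open_metric_ball.
- by move=> x _; exists x; rewrite //= d0; case: (eP x).
have [c c0 cD] := exists_pos_lbound (enum_fset D) (fun x => (eP x).1).
exists c => // x; have [//|z /= zD zx] := DX x.
have [ez [A UA zA]] := eP z; exists A => // y /= xy; apply: zA => /=.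
by apply: le_lt_trans (dD _ x _) _; rewrite ltrD// (lt_le_trans xy)// cD.
Qed.

Lemma diam_ge0 A : (0 <= diam d A)%E.
Proof. by apply: ereal_sup_ubound; left. Qed.

Lemma le_diam A x y : A x -> A y -> ((d x y)%:E <= diam d A)%E.
Proof. by move=> Ax Ay; apply: ereal_sup_ubound; right; exists (x, y). Qed.

Lemma diam_pow_ge0 s A : (0 <= diam_pow d s A)%E.
Proof. by rewrite /diam_pow; case: ifP => // _; exact: poweR_ge0. Qed.

Lemma cover_entropy_le_hausdorff (f : X -> X) (U : set (set X)) (s L : R) :
  open_cover U -> 0 <= s -> hausdorff_measure d s [set: X] = 0%E ->
  1 < L -> (forall x y, d (f x) (f y) <= L * d x y) ->
  (cover_entropy R f U <= (s * ln L)%:E)%E.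
Proof.
move=> Uoc s0 Hs L1 fL.
have L0 : 0 < L by exact: lt_trans L1.
have [F0 F0U] := open_cover_finite_subcover Uoc.
have [e e0 eU] := lebesgue_number Uoc.
have e20 : 0 < e / 2 by rewrite divr_gt0.
(* Half of the budget [e ^ s] is for the Hausdorff sum, half for the enlargements. *)
pose eta := e `^ s / 2.
have eta0 : 0 < eta by rewrite divr_gt0// powR_gt0.
have : (hausdorff_premeasure d s (e / 2) [set: X] < eta%:E)%E.
  apply: (@le_lt_trans _ _ 0%E); last by rewrite lte_fin.
  by rewrite -Hs; apply: ereal_sup_ubound; exists (e / 2).
move=> /ereal_inf_lt[_ [V [VX Ve] <-] Veta].
(* Empty sets have weight 0 in [diam_pow], even for [s = 0], so only the nonempty ones are
   enlarged. *)
pose D := [set i | V i !=set0].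
(* [(q i).1] bounds the enlarged diameter, and [(q i).2] is the radius of the neighbourhood that
   makes the set open. The costs [eta / 2 ^ i.+1] add up to at most [eta]. *)
have /choice[q qP] : forall i, exists q : R * R, D i ->
    [/\ 0 < q.2, forall x y, V i x -> V i y -> d x y + q.2 + q.2 <= q.1,
      q.1 <= e & ((q.1 `^ s)%:E <=
        diam_pow d s (V i) + (eta / (2 ^ i.+1)%:R)%:E)%E].
  move=> i; have [[x Vx]|Di] := pselect (D i); last by exists (0, 0).
  have dfin : diam d (V i) \is a fin_num.
    rewrite ge0_fin_numE ?diam_ge0//; apply: le_lt_trans (Ve i) _.
    exact: ltry.
  have [|||q [pq qe qs]] := @powR_enlarge _ s (fine (diam d (V i))) e
      (eta / (2 ^ i.+1)%:R) s0.
  - by rewrite fine_ge0// diam_ge0.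
  - rewrite -lte_fin fineK//; apply: le_lt_trans (Ve i) _.
    by rewrite lte_fin ltr_pdivrMr// ltr_pMr// ltr1n.
  - by rewrite divr_gt0// ltr0n expn_gt0.
  exists (q, (q - fine (diam d (V i))) / 2) => _; split=> //=.
  - by rewrite divr_gt0// subr_gt0.
  - move=> y z Vy Vz; rewrite -addrA -splitr addrCA gerDl subr_le0.
    by rewrite -lee_fin fineK// le_diam.
  - rewrite /diam_pow ifF; last by apply/negP => /eqP Vi; rewrite Vi in Vx.
    by rewrite -(fineK dfin) poweR_EFin -EFinD lee_fin.
pose O i := \bigcup_(x in V i) [set y | d x y < (q i).2].
have OV i x y : D i -> O i x -> O i y -> d x y < (q i).1.
  move=> Di [x' Vx' /= x'x] [y' Vy' /= y'y]; have [_ h _ _] := qP i Di.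
  apply: lt_le_trans (h _ _ Vx' Vy').
  apply: le_lt_trans (dD _ x' _) _; rewrite dC [X in _ < X]addrC ltrD//.
  by apply: le_lt_trans (dD _ y' _) _; rewrite ltrD2l.
have [||I ID IX] := cX (D := D) (f := O).
- by move=> i _; apply: bigcup_open => x _; exact: open_metric_ball.
- move=> x /VX[i _ Vx]; have Di : D i by exists x.
  by exists i => //; exists x; rewrite //= d0; case: (qP i Di).
have q0 i : D i -> 0 < (q i).1.
  move=> Di; have [x Vx] := Di; have [h1 h2 _ _] := qP i Di.
  by apply: lt_le_trans (h2 x x Vx Vx); rewrite d0 add0r addr_gt0.
(* [G i] pairs an orbit block containing [O i] with its length, the escape time from the scale
   [(q i).1] to the Lebesgue number [e]. *)
have /choice[G GP] : forall i, exists G : set X * nat, D i ->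
   [/\ iterated_join f U G.2 G.1, (0 < G.2)%N, O i `<=` G.1 &
     expR (- (s * ln L) * G.2%:R) <= ((q i).1 / e) `^ s].
  move=> i; have [Di|Di] := pselect (D i); last by exists (set0, 0%N).
  have [_ _ qe _] := qP i Di; have [y Vy] := Di.
  have Oy : O i y by exists y; rewrite //= d0; case: (qP i Di).
  have [n [n0 nL nE]] := escape_time L1 (q0 i Di) qe.
  have /choice[A AP] : forall k, exists A, U A /\
      ((k < n)%N -> O i `<=` iter k f @^-1` A).
    move=> k; have [A UA kA] := eU (iter k f y); exists A; split=> // kn x Ox.
    apply: kA => /=; apply: (@le_lt_trans _ _ (L ^+ k * d y x)).
      elim: k {kn} => [|k IH]; first by rewrite mul1r.
      by rewrite !iterS exprS -mulrA (le_trans (fL _ _))// ler_pM2l.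
    apply: lt_le_trans (nL k kn).
    by rewrite ltr_pM2l ?exprn_gt0//; exact: OV.
  exists (\bigcap_(k in `I_n) (iter k f @^-1` A k), n) => _; split=> //=.
  - by exists A => // k; case: (AP k).
  - by move=> x Ox k /= kn; exact: (AP k).2.
  - exact: nE.
pose r := [seq G i | i <- enum_fset I].
have ID' i : i \in enum_fset I -> D i by move=> /ID; exact: set_mem.
have [M MP] : exists M : nat, forall i, i \in enum_fset I -> ((G i).2 <= M)%N.
  exists (\max_(i <- enum_fset I) (G i).2)%N => i iI.
  exact: leq_bigmax_seq.
have lam0 : 0 <= s * ln L by rewrite mulr_ge0// ln_ge0// ltW.
apply: (@cover_entropy_le _ _ f U x0 F0 F0U (expR (s * ln L * M%:R))).
  exact: expR_gt0.
apply: (cover_number_concat (r := r)) => //.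
- by have [A UA _] := eU x0; exists A.
- by move=> _ /mapP[i iI ->]; have [h1 h2 _ _] := GP i (ID' i iI); split=> //;
  exact: MP.
- move=> x; have [//|i /= iI Ox] := IX x.
  exists (G i); first exact: map_f.
  by have [_ _ h _] := GP i (ID' i iI); exact: h.
rewrite /r big_map.
have eSN0 : 0 < e `^ s by exact: powR_gt0.
(* The weights are at most [((q i).1 / e) ^ s], with total at most [(eta + eta) / e ^ s = 1]. *)
apply: (@le_trans _ _ (\sum_(i <- enum_fset I) (q i).1 `^ s / e `^ s)).
  rewrite big_seq [leRHS]big_seq; apply: ler_sum => i iI.
  have [_ _ _ h] := GP i (ID' i iI); apply: (le_trans h).
  rewrite -[e^-1]powR_inv1 ?(ltW e0)// powRM ?powR_ge0 ?(ltW (q0 _ (ID' _ iI)))//.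
  by rewrite -powRrM mulN1r powRN.
rewrite -mulr_suml ler_pdivrMr// mul1r.
have -> : e `^ s = eta + eta by rewrite /eta -splitr.
rewrite -lee_fin -sumEFin EFinD.
apply: (@le_trans _ _ (\sum_(i <- enum_fset I)
    (diam_pow d s (V i) + (eta / (2 ^ i.+1)%:R)%:E))%E).
  rewrite big_seq [leRHS]big_seq; apply: lee_sum => i iI.
  by have [] := qP i (ID' i iI).
rewrite big_split /=; apply: leeD.
  apply: le_trans (ltW Veta); apply: (lee_sum_fset_lim _ xpredT) => i _.
  exact: diam_pow_ge0.
apply: le_trans (epsilon_trick0 xpredT (ltW eta0)).
apply: (lee_sum_fset_lim _ xpredT) => i _.
by rewrite lee_fin divr_ge0// ?ltW.
Qed.

End hausdorff_entropy.

Lemma HD_ge0 (R : realType) (X : Type) (d : X -> X -> R) : (0 <= HD d)%E.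
Proof. by apply: le_ereal_inf_tmp => _ [s [s0 _] <-]; rewrite lee_fin. Qed.

Lemma logp_ge0 (R : realType) (y : \bar R) : (0 <= logp y)%E.
Proof. by rewrite /logp le_max lexx orbT. Qed.

Lemma Lip_ge0 (R : realType) (X : Type) (d : X -> X -> R) (f : X -> X) :
  (0 <= Lip d f)%E.
Proof. by apply: ereal_sup_ubound; left. Qed.

(** * The entropy bound for an arbitrary compatible metric *)

Section entropy_le_HausLip.
Variables (R : realType) (X : topologicalType) (d : X -> X -> R) (x0 : X).
Hypotheses (dc : compatible_metric d) (cX : cover_compact [set: X]).

Lemma Lip_le (f : X -> X) (L : R) : (Lip d f <= L%:E)%E ->
  forall x y, d (f x) (f y) <= L * d x y.
Proof.
have [[d_ge0 dE _ _] _] := dc.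
move=> fL x y; have [xy|] := eqVneq (d x y) 0.
  have dxx z : d z z = 0 by exact/dE.
  by have /dE-> := xy; rewrite !dxx mulr0.
move=> xy; have {}xy : 0 < d x y by rewrite lt_neqAle eq_sym xy d_ge0.
rewrite -ler_pdivrMr// -lee_fin; apply: le_trans fL.
by apply: ereal_sup_ubound; right; exists (x, y).
Qed.

Lemma topological_entropy_le_mul_infty (f : X -> X) :
  (topological_entropy R f <= mul_infty (HD d) (logp (Lip d f)))%E.
Proof.
rewrite /mul_infty; have [//|hN] := eqVneq (HD d) +oo%E; first by rewrite leey.
have [//|lN] := eqVneq (logp (Lip d f)) +oo%E; first by rewrite leey.
have : HD d \is a fin_num by rewrite ge0_fin_numE ?HD_ge0// ltey.
have : logp (Lip d f) \is a fin_num by rewrite ge0_fin_numE ?logp_ge0// ltey.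
move=> /fineK <- /fineK <- /=.
set h := fine (HD d); set l := fine (logp (Lip d f)).
have h0 : 0 <= h by rewrite fine_ge0// HD_ge0.
have l0 : 0 <= l by rewrite fine_ge0// logp_ge0.
apply: ge_ereal_sup => _ [U Uoc <-].
(* Raising both factors by [e] provides an exponent [s <= h + e] of measure zero and a Lipschitz
   constant [expR (l + e)] that exceeds 1 even when [l = 0]. *)
suff ub e : 0 < e -> (cover_entropy R f U <= ((h + e) * (l + e))%:E)%E.
  apply/lee_addgt0Pr => e e0; pose c := h + l + 1.
  have c0 : 0 < c by rewrite ltr_wpDl ?addr_ge0.
  (* As [t <= 1], the product grows by at most [t * c <= e]. *)
  pose t := Num.min 1 (e / c).
  have t0 : 0 < t by rewrite lt_min ltr01 divr_gt0.
  apply: (le_trans (ub t t0)); rewrite -EFinM -EFinD lee_fin.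
  have t1 : t <= 1 by rewrite ge_min lexx.
  have tc : t * c <= e by rewrite -ler_pdivlMr// ge_min lexx orbT.
  apply: le_trans (_ : h * l + t * c <= _); last by rewrite lerD2l.
  have -> : (h + t) * (l + t) = h * l + t * (h + l + t) by ring.
  by rewrite lerD2l ler_wpM2l ?(ltW t0)// /c lerD2l.
move=> e0.
have [_ [s [s0 Hs] <-]] : exists2 x, [set s%:E | s in
    [set s : R | 0 <= s /\ hausdorff_measure d s [set: X] = 0%E]] x &
    (x < (h + e)%:E)%E.
  apply: ereal_inf_lt; rewrite -/(HD d) -[HD d]fineK.
    by rewrite lte_fin ltrDl.
  by rewrite ge0_fin_numE ?HD_ge0// ltey.
rewrite lte_fin => /ltW sh.
have L1 : 1 < expR (l + e) by rewrite expR_gt1 ltr_wpDl.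
have LL : (Lip d f <= (expR (l + e))%:E)%E.
  have : (lne (Lip d f) <= l%:E)%E.
    by rewrite /l fineK ?le_max ?lexx// ge0_fin_numE ?logp_ge0// ltey.
  move=> lL; rewrite -(@lneK R (Lip d f)) ?in_itv/= ?Lip_ge0 ?leey//.
  rewrite -[X in (_ <= X)%E]/(expeR (l + e)%:E) lee_expeR.
  by apply: (le_trans lL); rewrite lee_fin lerDl ltW.
apply: le_trans (cover_entropy_le_hausdorff x0 dc cX Uoc s0 Hs L1 (Lip_le LL)) _.
by rewrite expRK lee_fin ler_wpM2r// addr_ge0// ltW.
Qed.

End entropy_le_HausLip.

(** * Real triangularization with eigenvalues sorted by modulus *)

Lemma eigenvalue_unitmx (F : fieldType) n (A : 'M[F]_n) a :
  eigenvalue A a = (A - a%:M \notin unitmx).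
Proof. by rewrite /eigenvalue /eigenspace kermx_eq0 row_free_unit. Qed.

Lemma eigenvalue_similar (F : fieldType) n (A B V : 'M[F]_n) a :
  V \in unitmx -> V *m A = B *m V -> eigenvalue A a = eigenvalue B a.
Proof.
move=> Vu VA; rewrite !eigenvalue_unitmx; congr negb.
have E : V *m (A - a%:M) = (B - a%:M) *m V.
  by rewrite mulmxBr mulmxBl VA scalar_mxC.
by have := congr1 (fun M => M \in unitmx) E; rewrite !unitmx_mul Vu andbT.
Qed.

Lemma eigenvalue_trig (F : fieldType) n (T : 'M[F]_n) i :
  is_trig_mx T -> eigenvalue T (T i i).
Proof.
move=> Tt; rewrite eigenvalue_unitmx unitmxE det_trig.
  by rewrite (bigD1 i)//= !mxE eqxx mulr1n subrr mul0r unitr0.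
apply/is_trig_mxP => k l kl; move/is_trig_mxP : Tt => /(_ k l kl).
by rewrite !mxE -val_eqE /= (ltn_eqF kl) => ->; rewrite subr0.
Qed.

(** Rank factorization writes [W] as an invertible matrix times the first [k] rows of an invertible
    one; an identity block extends the first factor. *)
Lemma row_free_complete (F : fieldType) k m (W : 'M[F]_(k, k + m)) :
  row_free W -> exists2 Q : 'M[F]_(k + m), Q \in unitmx & usubmx Q = W.
Proof.
move=> fW; exists (block_mx (col_ebase W) 0 0 1%:M *m row_ebase W).
  rewrite unitmx_mul row_ebase_unit andbT unitmxE det_lblock det1 mulr1.
  by rewrite -unitmxE col_ebase_unit.
rewrite -[RHS]mulmx_ebase (eqP fW) -mul_usub_mx; congr (_ *m _).
rewrite block_mxEv col_mxKu.
have -> : (pid_mx k : 'M[F]_(k, k + m)) = row_mx 1%:M 0.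
  apply/matrixP => i j; rewrite !mxE; case: splitP => j' Ej; rewrite !mxE Ej.
    by rewrite ltn_ord andbT.
  by have := ltn_ord i; case: eqP => //= ->; rewrite ltnNge leq_addr.
by rewrite mul_mx_row mulmx1 mulmx0.
Qed.

Lemma normc_ge0 (R : rcfType) (z : R[i]) : 0 <= normc z.
Proof. by case: z => p q; exact: sqrtr_ge0. Qed.

Section triangularization.
Variable R : rcfType.
Local Notation C := R[i].
Local Notation toC := (map_mx (real_complex R)).

(* The change of basis [Y] is real, and [J] only combines coordinates whose
   eigenvalues have the same modulus: boxes in the real coordinates [Y x] can
   thus replace boxes in the triangular coordinates [J Y x]. *)
Definition real_triangular n (A Y : 'M[R]_n) (J T : 'M[C]_n) : Prop :=
  [/\ Y \in unitmx, J \in unitmx,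
      J *m toC Y *m toC A = T *m (J *m toC Y),
      is_trig_mx T &
      (forall i j, J i j != 0 -> normc (T i i) = normc (T j j)) /\
      (forall i j : 'I_n, (i <= j)%N -> normc (T j j) <= normc (T i i))].

(** Deflation: in a basis starting with the rows of [W], the matrix becomes block lower triangular
    with diagonal blocks [K] and [A'], and [A'] is triangularized by assumption. Since [rho] bounds
    all eigenvalues, the block of [K] comes first in the ordering of moduli. *)
Lemma real_triangular_step k m (A : 'M[R]_(k + m)) (K : 'M[R]_k)
    (W : 'M[R]_(k, k + m)) (J0 : 'M[C]_k) (d0 : 'rV[C]_k) (rho : R) :
  row_free W -> W *m A = K *m W -> J0 \in unitmx ->
  J0 *m toC K = diag_mx d0 *m J0 ->
  (forall i, normc (d0 0 i) = rho) ->
  (forall a, eigenvalue (toC A) a -> normc a <= rho) ->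
  (forall B : 'M[R]_m, exists Y J T, real_triangular B Y J T) ->
  exists Y J T, real_triangular A Y J T.
Proof.
move=> fW WA J0u J0K d0E Arho IH.
have [Q Qu QW] := row_free_complete fW.
pose M := Q *m A *m invmx Q.
have QA : Q *m A = M *m Q by rewrite /M -mulmxA mulVmx// mulmx1.
have ME : M = block_mx K 0 (dlsubmx M) (drsubmx M).
  have uM : usubmx M = row_mx K 0.
    rewrite /M -!mul_usub_mx QW WA -mulmxA -QW mul_usub_mx mulmxV//.
    by rewrite scalar_mx_block block_mxEv col_mxKu mul_mx_row mulmx1 mulmx0.
  by rewrite -[LHS]submxK /ulsubmx /ursubmx uM row_mxKl row_mxKr.
move: (dlsubmx M) (drsubmx M) ME => X A' ME.
have [Y' [J' [T' [Y'u J'u E T't [J'0 T's]]]]] := IH A'.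
pose D := diag_mx d0.
pose Y := block_mx 1%:M 0 0 Y' *m Q.
pose J := block_mx J0 0 0 J'.
(* The lower left block is the solution [Z] of [Z *m J0 = J' *m toC Y' *m toC X]. *)
pose T := block_mx D 0 (J' *m toC Y' *m toC X *m invmx J0) T'.
have Yu : Y \in unitmx.
  by rewrite unitmx_mul Qu andbT unitmxE det_lblock det1 mul1r -unitmxE.
have Ju : J \in unitmx.
  by rewrite unitmxE det_lblock unitrM -!unitmxE J0u.
have JY : J *m toC Y *m toC A = T *m (J *m toC Y).
  rewrite /Y map_mxM -!mulmxA -[toC Q *m _]map_mxM QA map_mxM !mulmxA;
    congr (_ *m _).
  rewrite ME !map_block_mx !map_mx0 map_mx1 /J !mulmx_block.
  rewrite !(mulmx0, mul0mx, mulmx1, addr0, add0r) J0K E.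
  rewrite (mulmxKV J0u) [T' *m (_ *m _)]mulmxA; reflexivity.
have Tt : is_trig_mx T by rewrite is_trig_block_mx// eqxx diag_mx_is_trig.
have dT i : T (lshift m i) (lshift m i) = d0 0 i.
  by rewrite block_mxEul mxE eqxx.
have dT' i : T (rshift k i) (rshift k i) = T' i i by rewrite block_mxEdr.
have Trho i : normc (T i i) <= rho.
  apply: Arho; rewrite (@eigenvalue_similar _ _ _ T (J *m toC Y))//.
    exact: eigenvalue_trig.
  by rewrite unitmx_mul Ju map_unitmx.
exists Y, J, T; split => //; split=> i j.
  case: (split_ordP i) => {}i ->; case: (split_ordP j) => {}j ->.
  - by rewrite !dT !d0E.
  - by rewrite block_mxEur mxE eqxx.
  - by rewrite block_mxEdl mxE eqxx.
  - by rewrite block_mxEdr !dT'; exact: J'0.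
case: (split_ordP i) => {}i -> ij; first by rewrite dT d0E.
case: (split_ordP j) ij => {}j -> /=.
  by rewrite leqNgt ltn_addr.
by rewrite leq_add2l !dT'; exact: T's.
Qed.


Lemma exists_max_eigenvalue n (A : 'M[C]_n.+1) :
  exists2 a, eigenvalue A a & forall b, eigenvalue A b -> normc b <= normc a.
Proof.
have [r rE] := closed_field_poly_normal (char_poly A).
have rP b : eigenvalue A b = (b \in r).
  rewrite eigenvalue_root_char rE rootZ ?lead_coef_eq0 ?monic_neq0//.
    by rewrite root_prod_XsubC.
  exact: char_poly_monic.
have : r != [::].
  apply/eqP => r0; have := size_char_poly A.
  by rewrite rE r0 big_nil (monicP (char_poly_monic A)) scale1r size_poly1.
(* The disjunct [r = [::]] only starts the induction; the degree of the characteristic polynomial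
   has excluded it. *)
have : exists2 a, r = [::] \/ a \in r & forall b, b \in r -> normc b <= normc a.
  elim: (r) => [|z s [a [->|as_] amax]].
  - by exists 0; [left|].
  - by exists z => [|b]; rewrite inE ?eqxx; [right|move=> /eqP ->].
  - have [za|/ltW az] := lerP (normc z) (normc a).
      exists a => [|b]; first by right; rewrite inE as_ orbT.
      by rewrite inE => /predU1P[->//|]; exact: amax.
    exists z => [|b]; first by right; rewrite inE eqxx.
    by rewrite inE => /predU1P[->//|/amax/le_trans]; apply.
move=> [a [->//|ar] amax] _; exists a; rewrite ?rP// => b.
by rewrite rP; exact: amax.
Qed.

Lemma map_mx_ReIm m n (v : 'M[C]_(m, n)) :
  v = toC (map_mx (@complex.Re R) v) + 'i%C *: toC (map_mx (@complex.Im R) v).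
Proof. by apply/matrixP => i j; rewrite !mxE [LHS]complexE. Qed.

Lemma Re_mulmx_real m n p (v : 'M[C]_(m, n)) (A : 'M[R]_(n, p)) :
  map_mx (@complex.Re R) (v *m toC A) = map_mx (@complex.Re R) v *m A.
Proof.
apply/matrixP => i j; rewrite !mxE raddf_sum/=; apply: eq_bigr => k _.
by rewrite !mxE; case: (v i k) => x y /=; rewrite mulr0 subr0.
Qed.

Lemma Im_mulmx_real m n p (v : 'M[C]_(m, n)) (A : 'M[R]_(n, p)) :
  map_mx (@complex.Im R) (v *m toC A) = map_mx (@complex.Im R) v *m A.
Proof.
apply/matrixP => i j; rewrite !mxE raddf_sum/=; apply: eq_bigr => k _.
by rewrite !mxE; case: (v i k) => x y /=; rewrite mulr0 add0r.
Qed.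

(** A left eigenvector [x + i y] of maximal modulus splits off a real line when its eigenvalue is
    real, and otherwise the real plane spanned by [x] and [y], where the two conjugate eigenvalues
    have the same modulus. *)
Lemma real_triangularization n (A : 'M[R]_n) :
  exists Y J T, real_triangular A Y J T.
Proof.
elim/ltn_ind: n A => -[|n] IH A.
  exists 1%:M, 1%:M, 0; split; rewrite ?unitmx1// ?mx0_is_trig//.
  - by apply/matrixP => -[].
  - by split=> -[].
have [a /eigenvalueP[v va v0] amax] := exists_max_eigenvalue (toC A).
pose x := map_mx (@complex.Re R) v; pose y := map_mx (@complex.Im R) v.
have xA : x *m A = complex.Re a *: x - complex.Im a *: y.
  rewrite -Re_mulmx_real va; apply/matrixP => i j; rewrite !mxE.
  by case: (a) (v i j) => ? ? [].
have yA : y *m A = complex.Re a *: y + complex.Im a *: x.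
  rewrite -Im_mulmx_real va; apply/matrixP => i j; rewrite !mxE.
  by case: (a) (v i j) => ? ? [].
have [a0|a0] := eqVneq (complex.Im a) 0.
  have [u u0 uA] : exists2 u : 'rV[R]_n.+1, u != 0 & u *m A = complex.Re a *: u.
    have [x0|x0] := eqVneq x 0.
      exists y; last by rewrite yA a0 scale0r addr0.
      apply: contra_neq v0 => y0.
      by rewrite [v]map_mx_ReIm -/x -/y x0 y0 !map_mx0 scaler0 addr0.
    by exists x => //; rewrite xA a0 scale0r subr0.
  apply: (@real_triangular_step 1 n A (complex.Re a)%:M u 1%:M
           (const_mx a) (normc a)) => //.
  - by rewrite -row_leq_rank rank_rV u0.
  - by rewrite mul_scalar_mx.
  - by rewrite unitmx1.
  - rewrite mul1mx mulmx1; apply/matrixP => i j; rewrite !mxE !ord1/=.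
    by case: (a) a0 => ? ? /= ->.
  - by move=> i; rewrite mxE.
  - exact: IH.
(* Applying [A] to a relation [s x + t y = 0] and dividing by the imaginary part of [a] gives
   [t x - s y = 0]. Together they show that [s ^ 2 + t ^ 2] annihilates [x] and [y], which are not
   both zero. *)
have fW : row_free (col_mx x y).
  apply: inj_row_free => w; rewrite -[w]hsubmxK mul_row_col.
  rewrite [lsubmx w]mx11_scalar [rsubmx w]mx11_scalar !mul_scalar_mx.
  move: (lsubmx w 0 0) (rsubmx w 0 0) => s t st0.
  have ts0 : t *: x - s *: y = 0.
    apply: (scalerI a0); rewrite scaler0.
    have := congr1 (mulmxr A) st0; rewrite /= mul0mx mulmxDl -!scalemxAl xA yA.
    move=> <-; rewrite -[LHS]addr0 -[X in _ + X](scaler0 _ (complex.Re a)) -st0.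
    apply/matrixP => i j; rewrite !mxE; ring.
  have sx : (s ^+ 2 + t ^+ 2) *: x = 0.
    transitivity (s *: (s *: x + t *: y) + t *: (t *: x - s *: y)).
      by apply/matrixP => i j; rewrite !mxE; ring.
    by rewrite st0 ts0 !scaler0 addr0.
  have sy : (s ^+ 2 + t ^+ 2) *: y = 0.
    transitivity (t *: (s *: x + t *: y) - s *: (t *: x - s *: y)).
      by apply/matrixP => i j; rewrite !mxE; ring.
    by rewrite st0 ts0 !scaler0 subr0.
  have /eqP : s ^+ 2 + t ^+ 2 = 0.
    apply: contra_neq_eq v0 => st; rewrite [v]map_mx_ReIm -/x -/y.
    have /eqP := sx; rewrite scaler_eq0 (negbTE st) => /eqP ->.
    have /eqP := sy; rewrite scaler_eq0 (negbTE st) => /eqP ->.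
    by rewrite !map_mx0 scaler0 addr0.
  rewrite paddr_eq0 ?sqr_ge0// !sqrf_eq0 => /andP[/eqP -> /eqP ->].
  by rewrite raddf0 row_mx0.
(* Two independent rows force the dimension to be at least 2. *)
case: n => [|n] in IH A v va v0 amax x y xA yA fW *.
  by have := rank_leq_col (col_mx x y); rewrite (eqP fW).
(* [K] is the action of [A] on the plane; the rows of [J0] recombine [x] and [y] into the
   eigenvectors [x + i y] and [x - i y]. *)
pose K : 'M[R]_(1 + 1) := block_mx (complex.Re a)%:M (- complex.Im a)%:M
  (complex.Im a)%:M (complex.Re a)%:M.
pose J0 : 'M[C]_(1 + 1) := block_mx 1%:M ('i%C)%:M 1%:M (- 'i%C)%:M.
apply: (@real_triangular_step (1 + 1) n A K (col_mx x y : 'M[R]_(1 + 1, n.+2)) J0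
         (row_mx (const_mx a) (const_mx (conjc a)) : 'rV_(1 + 1)) (normc a)) =>
           //.
- rewrite /K mul_block_col mul_col_mx !mul_scalar_mx xA yA scaleNr.
  by rewrite [in RHS]addrC [in X in col_mx _ X = _]addrC [in X in _ = col_mx X
    _]addrC.
- suff : row_free J0 by rewrite row_free_unit.
  apply: inj_row_free => w.
  rewrite /J0 -[w]hsubmxK mul_row_block.
  rewrite [lsubmx w]mx11_scalar [rsubmx w]mx11_scalar -!scalar_mxM -!raddfD.
  move: (lsubmx w 0 0) (rsubmx w 0 0) => s t.
  rewrite -[0 : 'rV[C]_2](@row_mx0 _ 1 1 1) => /eq_row_mx[].
  rewrite !mulr1 mulrN -mulrBl => /matrixP/(_ 0 0) + /matrixP/(_ 0 0).
  rewrite !mxE !mulr1n => st /eqP; rewrite mulf_eq0 => /orP[|]; last first.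
    by rewrite eq_complex /= oner_eq0 andbF.
  rewrite subr_eq0 => /eqP E; move: st; rewrite E -mulr2n => /eqP.
  by rewrite mulrn_eq0/= => /eqP ->; rewrite raddf0 row_mx0.
- have diag1 (c : C) : diag_mx (const_mx c : 'rV_1) = c%:M.
    by apply/matrixP => i j; rewrite !mxE.
  rewrite /K /J0 map_block_mx !map_scalar_mx diag_mx_row !diag1 !mulmx_block.
  rewrite !mul0mx !addr0 !add0r -!scalar_mxM -!raddfD.
  by congr block_mx; congr (_%:M); case: (a) => p q; simpc.
- move=> i; case: (@split_ordP 1 1 i) => j ->; rewrite ?row_mxEl ?row_mxEr mxE//.
  by case: (a) => ? ? /=; rewrite sqrrN.
- by move=> B; apply: IH.
Qed.

(** Conjugation by the diagonal matrix of the powers [k ^ i] multiplies the entry [(i, j)] by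
    [k ^ (i - j)], which is at most [k] below the diagonal. It preserves the diagonal of [T] and the
    zero pattern of [J]. *)
Lemma real_triangular_small n (A : 'M[R]_n) (theta : R) : 0 < theta ->
  exists Y J T, real_triangular A Y J T /\
    forall i : 'I_n, \sum_(j < n | (j < i)%N) normc (T i j) <= theta.
Proof.
move=> theta0.
have [Y [J [T [Yu Ju E Tt [J0 Ts]]]]] := real_triangularization A.
have nc_ge0 (z : C) : 0 <= normc z by exact: normc_ge0.
pose c := 1 + \sum_i \sum_j normc (T i j).
have c0 : 0 < c by rewrite ltr_wpDr// sumr_ge0// => i _; rewrite sumr_ge0.
pose k : R := Num.min 1 (theta / c).
have k0 : 0 < k by rewrite lt_min ltr01 divr_gt0.
have k1 : k <= 1 by rewrite ge_min lexx.
have kc : k * c <= theta by rewrite -ler_pdivlMr// ge_min lexx orbT.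
have kX0 i : ((k ^+ i)%:C)%C != 0 :> C.
  by rewrite fmorph_eq0 expf_neq0// gt_eqF.
pose D : 'M[C]_n := diag_mx (\row_i ((k ^+ i)%:C)%C).
pose D' : 'M[C]_n := diag_mx (\row_i ((k ^+ i)%:C)%C^-1).
have D'D : D' *m D = 1%:M.
  rewrite mulmx_diag; apply/matrixP => i j; rewrite !mxE.
  by case: eqVneq => //= _; rewrite mulVf.
have DD' : D *m D' = 1%:M by exact: mulmx1C.
pose T1 := D *m T *m D'.
have T1E i j : T1 i j = (k ^+ i)%:C%C * T i j / (k ^+ j)%:C%C.
  by rewrite /T1 mul_mx_diag mul_diag_mx !mxE.
have T1d i : T1 i i = T i i by rewrite T1E mulrAC divff ?mul1r.
exists Y, (D *m J), T1; split; last first.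
  move=> i; apply: le_trans kc.
  apply: (@le_trans _ _ (\sum_(j < n | (j < i)%N) k * normc (T i j))).
    apply: ler_sum => j ji; rewrite T1E mulrAC -fmorph_div normcM.
    apply: ler_wpM2r => //.
    have -> : k ^+ i / k ^+ j = k ^+ (i - j).
      by rewrite -[X in k ^+ X](subnK (ltnW ji)) exprD mulfK// expf_neq0 ?gt_eqF.
    rewrite /= expr0n /= addr0 sqrtr_sqr ger0_norm ?exprn_ge0 ?(ltW k0)//.
    rewrite -[X in k ^+ X](prednK (n := i - j)) ?subn_gt0// exprS.
    by rewrite ler_piMr ?(ltW k0)// exprn_ile1// ltW.
  rewrite -mulr_sumr ler_wpM2l ?(ltW k0)// ler_wpDl// [leRHS](bigD1 i)//=.
  apply: ler_wpDr.
    by rewrite sumr_ge0// => l _; rewrite sumr_ge0.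
  by rewrite [leRHS](bigID (fun j : 'I_n => (j < i)%N))/= lerDl sumr_ge0.
split=> //.
- by rewrite unitmx_mul Ju andbT; case: (mulmx1_unit DD').
- rewrite /T1 -!mulmxA (mulmxA D') D'D mul1mx; congr (_ *m _).
  by move: E; rewrite !mulmxA => ->.
- apply/is_trig_mxP => i j ij; rewrite T1E.
  by move/is_trig_mxP : Tt => ->; rewrite ?mulr0 ?mul0r.
- split=> i j; rewrite !T1d; last exact: Ts.
  by rewrite mul_diag_mx !mxE mulf_eq0 negb_or => /andP[_]; exact: J0.
Qed.

End triangularization.

(** * Metrics on the torus *)

Lemma int_num_lt1_eq0 (R : realType) (x : R) :
  x \is a Num.int -> `|x| < 1 -> x = 0.
Proof.
move=> /intrP[m ->]; rewrite -intr_norm -[1]/(1%:~R) ltr_int => m1.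
suff -> : m = 0 by [].
by apply/eqP; rewrite -normr_eq0 eq_le normr_ge0 andbT -ltzD1.
Qed.

Section torus.
Variables (R : realType) (n : nat).
Local Notation proj := (@torus_proj R n).

Lemma torus_projK (t : torus R n) : exists x, proj x = t.
Proof.
exists (generic_quotient.repr (t : ring_quotient.Quotient.quot (Zn R n))).
exact: generic_quotient.reprK.
Qed.

Lemma torus_openE (A : set (torus R n)) : open A <->
  forall x, A (proj x) -> exists2 e : R, 0 < e &
    forall y : 'cV[R]_n, (forall i, `|x i 0 - y i 0| < e) -> A (proj y).
Proof.
have -> : open A <-> open (proj @^-1` A) by [].
rewrite openE; split=> [Ao x Ax|Ao x /= Ax].
  have [e /= e0 eA] := (nbhs_ballP _ _).1 (Ao x Ax).
  exists e => // y xy; apply: eA; split=> // i j.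
  by rewrite ord1; exact: xy.
have [e e0 eA] := Ao x Ax; apply/nbhs_ballP; exists e => //= y [_ xy].
by apply: eA => i; exact: xy.
Qed.

(** The torus is the image of the unit cube: subtracting integer parts moves any lift into it. *)
Lemma torus_cover_compact : cover_compact [set: torus R n].
Proof.
move=> I D F Fo FX.
pose T : 'rV[R]_n -> torus R n := fun v => proj v^T.
pose Q := [set v : 'rV[R]_n | forall i, `[0, 1]%classic (v 0 i)].
have Qc : compact Q.
  by apply: (@rV_compact R n (fun=> `[0, 1]%classic)) => i;
    exact: segment_compact.
have Qcc : cover_compact Q by rewrite -compact_cover.
have [||E ED QE] := Qcc I D (fun i => T @^-1` F i).
- move=> i Di; rewrite openE => v /= Fv; apply/nbhs_ballP.
  have /torus_openE/(_ _ Fv)[e e0 eF] := Fo i Di; exists e => //= w [_ vw].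
  by apply: eF => j; rewrite !mxE; exact: vw.
- by move=> v _; have [//|i Di Fi] := FX (T v); exists i.
exists E => // t _; have [x <-] := torus_projK t.
have [|i iE Fi] := QE (\row_i (x i 0 - (Num.floor (x i 0))%:~R)).
  move=> i /=; rewrite mxE in_itv /=.
  by have := real_floor_itv (num_real (x i 0)); rewrite intrD; lra.
exists i => //; suff -> : proj x = T (\row_i (x i 0 - (Num.floor (x i 0))%:~R))
  by [].
by apply/torus_projP => j; rewrite !mxE opprB addrC subrK intr_int.
Qed.

(** * The quotient metric of a gauge on the universal cover *)

Variable G : 'cV[R]_n -> R.
Hypotheses (G_ge0 : forall z, 0 <= G z) (GN : forall z, G (- z) = G z).
Hypothesis GD : forall x y, G (x + y) <= G x + G y.
Hypothesis Gsmall : forall e, 0 < e ->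
  exists2 h, 0 < h & forall z, G z < h -> forall i, `|z i 0| < e.
Hypothesis Gcont : forall e, 0 < e ->
  exists2 h, 0 < h & forall z : 'cV[R]_n, (forall i, `|z i 0| < h) -> G z < e.

Definition torus_dist (t u : torus R n) : R :=
  inf [set G (xy.1 - xy.2) | xy in
    [set xy : 'cV[R]_n * 'cV[R]_n | proj xy.1 = t /\ proj xy.2 = u]].

Let has_inf_dist t u : has_inf [set G (xy.1 - xy.2) | xy in
    [set xy : 'cV[R]_n * 'cV[R]_n | proj xy.1 = t /\ proj xy.2 = u]].
Proof.
have [x xt] := torus_projK t; have [y yu] := torus_projK u.
split; first by exists (G (x - y)), (x, y).
by exists 0 => _ [xy _ <-].
Qed.

Lemma torus_dist_le x y : torus_dist (proj x) (proj y) <= G (x - y).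
Proof. by apply: ge_inf; [exact: (has_inf_dist _ _).2|exists (x, y)]. Qed.

Lemma torus_dist_lt x y e : torus_dist (proj x) (proj y) < e ->
  exists k : 'cV[R]_n, (forall i, k i 0 \is a Num.int) /\ G (x - y + k) < e.
Proof.
move=> /inf_lt[|_ [[x' y'] [/= /torus_projP xx /torus_projP yy] <-] h].
  exact: (has_inf_dist _ _).1.
exists (x' - x - (y' - y)); split=> [i|].
  by rewrite !mxE rpredB.
suff -> : x - y + (x' - x - (y' - y)) = x' - y' by [].
by apply/matrixP => i j; rewrite !mxE; ring.
Qed.

Lemma torus_dist_ge0 t u : 0 <= torus_dist t u.
Proof. by apply: lb_le_inf; [exact: (has_inf_dist _ _).1|move=> _ [xy _ <-]]. Qed.

Let G0 : G 0 = 0.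
Proof.
apply/eqP; rewrite eq_le G_ge0 andbT; apply/ler_addgt0Pr => e e0.
by rewrite add0r; have [h h0 hG] := Gcont e0; apply/ltW/hG => i;
  rewrite mxE normr0.
Qed.

Lemma torus_dist_is_metric : is_metric torus_dist.
Proof.
split.
- exact: torus_dist_ge0.
- move=> t u; split=> [|->]; last first.
    have [x <-] := torus_projK u; apply/eqP; rewrite eq_le torus_dist_ge0 andbT.
    by apply: (le_trans (torus_dist_le _ _)); rewrite subrr G0.
  have [x <-] := torus_projK t; have [y <-] := torus_projK u => xy0.
  (* Two lattice vectors bringing [x - y] within 1/2 of 0 in each coordinate differ by less than 1,
     hence coincide. A single [k] thus serves all scales, and [x - y + k] vanishes. *)
  have [|h h0 hG] := @Gsmall (1 / 2); first by rewrite divr_gt0.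
  have [|k [ki kh]] := @torus_dist_lt x y h; first by rewrite xy0.
  suff /matrixP xyk : x - y + k = 0.
    apply/torus_projP => i; have := xyk i 0; rewrite !mxE => /eqP.
    by rewrite addr_eq0 => /eqP ->; rewrite rpredN.
  suff small e : 0 < e -> forall i, `|(x - y + k) i 0| < e.
    apply/matrixP => i j; rewrite ord1 [RHS]mxE.
    apply/eqP; rewrite -normr_le0; apply/ler_addgt0Pr => e /small/(_ i)/ltW.
    by rewrite add0r.
  move=> e0; have [h' h'0 h'G] := Gsmall e0.
  have [|k' [k'i]] := @torus_dist_lt x y (Num.min h h').
    by rewrite xy0 lt_min h0.
  rewrite lt_min => /andP[/hG k'h /h'G]; suff -> : k = k' by [].
  apply/matrixP => i j; rewrite ord1; apply/eqP; rewrite -subr_eq0; apply/eqP.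
  apply: int_num_lt1_eq0; first by rewrite rpredB.
  have := hG _ kh i; have := k'h i; rewrite !mxE !ltr_norml; lra.
- suff sym t u : torus_dist t u <= torus_dist u t.
    by move=> t u; apply/eqP; rewrite eq_le !sym.
  apply: lb_le_inf => [|_ [[x y] [/= <- <-] <-]];
    first exact: (has_inf_dist _ _).1.
  by rewrite -GN opprB torus_dist_le.
- move=> t u v; apply/ler_addgt0Pr => e e0.
  have [x <-] := torus_projK t; have [y <-] := torus_projK u.
  have [z <-] := torus_projK v.
  have e20 : 0 < e / 2 by rewrite divr_gt0.
  have [|k [ki kh]] := @torus_dist_lt x y (torus_dist (proj x) (proj y) + e / 2).
    by rewrite ltrDl.
  have [|l [li lh]] := @torus_dist_lt y z (torus_dist (proj y) (proj z) + e / 2).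
    by rewrite ltrDl.
  (* Changing the lift of the third point aligns the two nearly optimal pairs. *)
  have zE : proj z = proj (z - k - l).
    apply/torus_projP => i; rewrite !mxE.
    have -> : z i 0 - (z i 0 - k i 0 - l i 0) = k i 0 + l i 0 by ring.
    by rewrite rpredD.
  rewrite [in leLHS]zE; apply: (le_trans (torus_dist_le _ _)).
  have -> : x - (z - k - l) = (x - y + k) + (y - z + l).
    by apply/matrixP => i j; rewrite !mxE; ring.
  apply: (le_trans (GD _ _)); apply: (le_trans (lerD (ltW kh) (ltW lh))).
  by rewrite addrACA -splitr.
Qed.

Lemma torus_dist_compatible : compatible_metric torus_dist.
Proof.
split; first exact: torus_dist_is_metric.
move=> A; split=> [/torus_openE Ao t|Ao].
  have [x <-] := torus_projK t => /Ao[e e0 eA].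
  have [h h0 hG] := Gsmall e0; exists h => // u /=.
  have [y <-] := torus_projK u => /torus_dist_lt[k [ki /hG kh]].
  suff -> : proj y = proj (y - k).
    by apply: eA => i; have := kh i; rewrite !mxE opprB addrA addrAC.
  by apply/torus_projP => i; rewrite !mxE opprB addrC subrK.
apply/torus_openE => x /Ao[e e0 eA]; have [h h0 hG] := Gcont e0.
exists h => // y xy; apply: eA => /=; apply: le_lt_trans (torus_dist_le _ _) _.
by apply: hG => i; rewrite !mxE.
Qed.

Lemma torus_dist_linear (A : 'M[int]_n) (f : torus R n -> torus R n) (L : R) :
  (forall x, f (proj x) = proj (map_mx intr A *m x)) -> 0 < L ->
  (forall z, G (map_mx intr A *m z) <= L * G z) ->
  forall t u, torus_dist (f t) (f u) <= L * torus_dist t u.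
Proof.
move=> fA L0 GA t u; rewrite -ler_pdivrMl//.
apply: lb_le_inf => [|_ [[x y] [/= <- <-] <-]]; first exact: (has_inf_dist _ _).1.
by rewrite ler_pdivrMl// !fA; apply: le_trans (GA _);
  rewrite mulmxBr torus_dist_le.
Qed.

End torus.

(** * Hausdorff dimension and box counting *)

Lemma nneseries_finite (R : realType) (u : (\bar R)^nat) (N : nat) (c : R) :
  (forall i, (i < N)%N -> (0 <= u i <= c%:E)%E) ->
  (forall i, (N <= i)%N -> u i = 0%E) ->
  (\sum_(0 <= i <oo) u i <= (N%:R * c)%:E)%E.
Proof.
move=> uc u0.
have uge0 i : (0 <= u i)%E.
  by have [/uc/andP[]//|/u0 ->] := ltnP i N.
rewrite (nneseries_split 0 N)// [X in (_ + X)%E]eseries0 ?adde0; last first.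
  by move=> i Ni _; rewrite u0.
rewrite add0n big_mkord; apply: (@le_trans _ _ (\sum_(i < N) c%:E)%E).
  by apply: lee_sum => i _; case/andP: (uc i (ltn_ord i)).
by rewrite sumEFin sumr_const card_ord mulr_natl.
Qed.

(** At the exponent [S + e], covering by boxes of size [r] gives sums of at most [C * r ^ e], which
    tend to 0 with [r]. *)
Lemma HD_le_box (R : realType) (X : Type) (d : X -> X -> R) (C S : R) :
  0 <= S -> 0 < C ->
  (forall r, 0 < r <= 1 -> exists (I : finType) (cell : I -> set X),
     [/\ forall x, exists i, cell i x,
         forall i x y, cell i x -> cell i y -> d x y <= r &
         #|I|%:R * r `^ S <= C]) ->
  (HD d <= S%:E)%E.
Proof.
move=> S0 C0 box; apply/lee_addgt0Pr => e e0.
rewrite -EFinD; set s := S + e.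
have s0 : 0 <= s by rewrite addr_ge0// ltW.
apply: ereal_inf_lbound; exists s => //; split=> //.
apply/eqP; rewrite eq_le; apply/andP; split; last first.
  apply: le_ereal_sup_tmp.
  exists (hausdorff_premeasure d s 1 [set: X]); first by exists 1 => //=.
  apply: le_ereal_inf_tmp => _ [U _ <-]; apply: nneseries_ge0 => i _ _.
  by rewrite /diam_pow; case: ifP => // _; exact: poweR_ge0.
apply: ge_ereal_sup => _ [delta /= delta0 <-].
apply/lee_addgt0Pr => t t0; rewrite add0e.
pose r := Num.min (Num.min 1 delta) ((t / C) `^ e^-1).
have tC0 : 0 < t / C by rewrite divr_gt0.
have r0 : 0 < r by rewrite !lt_min ltr01 delta0 powR_gt0.
have r1 : r <= 1 by rewrite !ge_min lexx.
have rd : r <= delta by rewrite !ge_min lexx orbT.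
have re : r `^ e <= t / C.
  rewrite -[leRHS]powRr1 ?(ltW tC0)// -(@mulVf _ e) ?gt_eqF// powRrM.
  apply: ge0_ler_powR; rewrite ?nnegrE ?powR_ge0 ?(ltW r0) ?(ltW e0)//.
  by rewrite ge_min lexx orbT.
have [I [cell [cellX celld cardI]]] := box r (introT andP (conj r0 r1)).
(* The finite family is continued by empty sets, whose weight is 0. *)
pose U i := if insub i is Some k then cell (enum_val (k : 'I_#|I|)) else set0.
have diamU i : (diam d (U i) <= r%:E)%E.
  apply: ge_ereal_sup => y [->|]; first by rewrite lee_fin ltW.
  move=> [[x z] /= [Ux Uz] <-]; rewrite lee_fin.
  by move: Ux Uz; rewrite /U; case: insubP => // k _ _; exact: celld.
apply: (@le_trans _ _ (\sum_(0 <= i <oo) diam_pow d s (U i))%E).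
  apply: ereal_inf_lbound; exists U => //; split=> [x _|i]; last first.
    by apply: (le_trans (diamU i)); rewrite lee_fin.
  have [k kx] := cellX x; exists (enum_rank k) => //.
  by rewrite /U insubT//= => kI;
    rewrite (_ : Sub _ _ = enum_rank k) ?enum_rankK//; exact: val_inj.
apply: (@le_trans _ _ (#|I|%:R * r `^ s)%:E).
  apply: nneseries_finite => i iI.
    rewrite /diam_pow; case: ifP => _; first by rewrite lexx lee_fin powR_ge0.
    rewrite poweR_ge0/= -poweR_EFin; apply: gt0_ler_poweR => //.
      by rewrite in_itv/= leey andbT; apply: ereal_sup_ubound; left.
    by rewrite in_itv/= leey andbT lee_fin ltW.
  by rewrite /diam_pow /U insubF ?eqxx// ltnNge iI.
rewrite lee_fin /s powRD; last by rewrite (gt_eqF r0) implybT.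
rewrite mulrA; apply: le_trans (_ : C * (t / C) <= _); last first.
  by rewrite mulrC divfK// gt_eqF.
by apply: ler_pM => //; rewrite ?mulr_ge0 ?powR_ge0.
Qed.

(** A fraction [t] between 0 and 1 satisfies [t <= t ^ a]; apply this to [x / (x + y)] and
    [y / (x + y)], whose sum is 1. *)
Lemma powR_subadd (R : realType) (a x y : R) :
  0 < a <= 1 -> 0 <= x -> 0 <= y -> (x + y) `^ a <= x `^ a + y `^ a.
Proof.
move=> /andP[a0 a1] x0 y0; have [xy|xy] := eqVneq (x + y) 0.
  by rewrite xy powR0 ?gt_eqF// addr_ge0 ?powR_ge0.
have {}xy : 0 < x + y by rewrite lt_neqAle eq_sym xy addr_ge0.
have frac z : 0 <= z -> z <= x + y -> z / (x + y) * (x + y) `^ a <= z `^ a.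
  move=> z0 zxy; have [->|zN0] := eqVneq z 0; first by rewrite !mul0r powR_ge0.
  have {}z0 : 0 < z by rewrite lt_neqAle eq_sym zN0.
  have {2}-> : z = z / (x + y) * (x + y) by rewrite divfK// gt_eqF.
  rewrite powRM ?divr_ge0 ?(ltW z0) ?(ltW xy)// ler_wpM2r ?powR_ge0//.
  by rewrite ger1_powR// divr_gt0//= ler_pdivrMr ?mul1r.
have -> : (x + y) `^ a = x / (x + y) * (x + y) `^ a + y / (x + y) * (x + y) `^ a.
  by rewrite -mulrDl -mulrDl divff ?mul1r// gt_eqF.
by rewrite lerD// frac// ?lerDl ?lerDr.
Qed.

(** * Modulus estimates for complex matrices *)

Section complex_norm.
Variable R : rcfType.
Implicit Types z : R[i].

Lemma normc_real (x : R) : normc (x%:C)%C = `|x|.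
Proof. by rewrite /= expr0n addr0 sqrtr_sqr. Qed.

Lemma normc_sum (I : Type) (s : seq I) (P : pred I) (F : I -> R[i]) :
  normc (\sum_(i <- s | P i) F i) <= \sum_(i <- s | P i) normc (F i).
Proof.
elim/big_ind2 : _ => [|x a y c xa yc|//]; first by rewrite normc0.
by apply: le_trans (le_normcD _ _) _; exact: lerD.
Qed.

Lemma normc_mulmx m n (M : 'M[R[i]]_(m, n)) (w : 'cV[R[i]]_n) i :
  normc ((M *m w) i 0) <= \sum_j normc (M i j) * normc (w j 0).
Proof.
rewrite mxE; apply: le_trans (normc_sum _ _ _) _.
by apply: ler_sum => j _; rewrite normcM.
Qed.

(** A crude bound for the operator norm in the maximum norm; the summand 1 makes it positive and the
    estimates strict. *)
Definition mxsum m n (M : 'M[R[i]]_(m, n)) : R := 1 + \sum_i \sum_j normc (M i j).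

Lemma mxsum_gt0 m n (M : 'M[R[i]]_(m, n)) : 0 < mxsum M.
Proof.
by rewrite ltr_wpDr// sumr_ge0// => i _; rewrite sumr_ge0// => j _;
  exact: normc_ge0.
Qed.

Lemma row_sum_lt_mxsum m n (M : 'M[R[i]]_(m, n)) i :
  \sum_j normc (M i j) < mxsum M.
Proof.
apply: (@le_lt_trans _ _ (\sum_i \sum_j normc (M i j))); last by rewrite ltrDr.
rewrite [leRHS](bigD1 i)//= lerDl sumr_ge0// => k _.
by rewrite sumr_ge0// => j _; exact: normc_ge0.
Qed.

Lemma normc_mulmx_le m n (M : 'M[R[i]]_(m, n)) (w : 'cV[R[i]]_n) i c :
  (forall j, normc (w j 0) <= c) ->
  normc ((M *m w) i 0) <= (\sum_j normc (M i j)) * c.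
Proof.
move=> wc; apply: le_trans (normc_mulmx _ _ _) _; rewrite mulr_suml.
by apply: ler_sum => j _; rewrite ler_wpM2l// normc_ge0.
Qed.

Lemma normc_mulmx_lt m n (M : 'M[R[i]]_(m, n)) (w : 'cV[R[i]]_n) i c :
  0 < c -> (forall j, normc (w j 0) <= c) -> normc ((M *m w) i 0) < mxsum M * c.
Proof.
move=> c0 wc; apply: le_lt_trans (normc_mulmx_le _ _ wc) _.
by rewrite ltr_pM2r// row_sum_lt_mxsum.
Qed.

End complex_norm.

(** * The snowflaked gauge in triangular coordinates *)

Section triangular_metric.
Variables (R : realType) (n : nat) (b : R) (A Y : 'M[R]_n) (J T : 'M[R[i]]_n).
Local Notation toC := (map_mx (real_complex R)).
Hypotheses (b0 : 0 < b) (YJT : real_triangular A Y J T).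
Hypothesis Tsmall :
  forall i : 'I_n, \sum_(j < n | (j < i)%N) normc (T i j) <= expR b - 1.

Let a (i : 'I_n) : R := ln (Num.max 1 (normc (T i i))) + b.
Let V := J *m toC Y.
Let N (z : 'cV[R]_n) (i : 'I_n) : R := normc ((V *m toC z) i 0).
Let D (z : 'cV[R]_n) : R := \big[Num.max/0]_i (N z i `^ (b / a i)).

(** The estimate for [D (A z)] relies on [D z <= 1]; truncation at 1 makes the Lipschitz bound
    global and leaves small values, hence the topology, unchanged. *)
Definition triangular_gauge (z : 'cV[R]_n) : R := Num.min 1 (D z).
Local Notation G := triangular_gauge.

Let a_ge i : b <= a i.
Proof. by rewrite /a lerDr ln_ge0// le_max lexx. Qed.

Let a_gt0 i : 0 < a i. Proof. exact: lt_le_trans (a_ge i). Qed.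

Let alpha01 i : 0 < b / a i <= 1.
Proof. by rewrite divr_gt0//= ler_pdivrMr// mul1r. Qed.

Let alpha_gt0 i : 0 < b / a i. Proof. by case/andP: (alpha01 i). Qed.

Let a_anti (i j : 'I_n) : (i <= j)%N -> a j <= a i.
Proof.
have [_ _ _ _ [_ Ts]] := YJT => ij; rewrite lerD2r.
rewrite ler_ln ?posrE ?lt_max ?ltr01//.
by rewrite ge_max !le_max lexx/= Ts// orbT.
Qed.

(** This dictates the bound in [Tsmall]: with [m = max 1 rho_i], [rho_i + (e^b - 1) <= m e^b]
    because [(m - 1) (e^b - 1) >= 0]. *)
Let expR_a i : normc (T i i) + (expR b - 1) <= expR (a i).
Proof.
rewrite expRD lnK ?posrE ?lt_max ?ltr01//; set m := Num.max _ _.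
have m1 : 1 <= m by rewrite le_max lexx.
have mT : normc (T i i) <= m by rewrite le_max lexx orbT.
have b1 : 1 <= expR b by rewrite -[leLHS]expR0 ler_expR ltW.
have : 0 <= (m - 1) * (expR b - 1) by rewrite mulr_ge0// subr_ge0.
by rewrite mulrBl mulrBr; lra.
Qed.

Let V_unit : V \in unitmx.
Proof. by have [Yu Ju _ _ _] := YJT; rewrite unitmx_mul Ju map_unitmx. Qed.

Let N_ge0 z i : 0 <= N z i. Proof. exact: normc_ge0. Qed.

Let ND x y i : N (x + y) i <= N x i + N y i.
Proof. by rewrite /N map_mxD mulmxDr mxE le_normcD. Qed.

Let NN z i : N (- z) i = N z i.
Proof. by rewrite /N map_mxN mulmxN mxE normcN. Qed.

Let N_lt (z : 'cV[R]_n) i (c : R) : 0 < c -> (forall j, `|z j 0| <= c) -> N z i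
  < mxsum V * c.
Proof. by move=> c0 zc; apply: normc_mulmx_lt => // j;
  rewrite mxE normc_real. Qed.

Let norm_lt (z : 'cV[R]_n) i (c : R) : 0 < c -> (forall j, N z j <= c) ->
  `|z i 0| < mxsum (invmx V) * c.
Proof.
move=> c0 zc; rewrite -normc_real.
have -> : (z i 0)%:C%C = (invmx V *m (V *m toC z)) i 0.
  by rewrite mulKmx// mxE.
exact: normc_mulmx_lt.
Qed.

Let D_ge0 z : 0 <= D z.
Proof.
by rewrite /D; elim/big_ind : _ => // [x y x0 y0|i _];
  rewrite ?powR_ge0// le_max x0.
Qed.

Let le_D z i : N z i `^ (b / a i) <= D z.
Proof. exact: (le_bigmax _ (fun i => N z i `^ (b / a i))). Qed.

Let D_le z (c : R) : 0 <= c -> (forall i, N z i `^ (b / a i) <= c) -> D z <= c.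
Proof. by move=> c0 h; apply: bigmax_le. Qed.

Lemma triangular_gauge_ge0 z : 0 <= G z.
Proof. by rewrite le_min ler01 D_ge0. Qed.

Lemma triangular_gaugeN z : G (- z) = G z.
Proof. 
rewrite /triangular_gauge; suff -> : D (- z) = D z by [].
by apply: eq_bigr => i _; rewrite NN. Qed.

Lemma triangular_gaugeD x y : G (x + y) <= G x + G y.
Proof.
have G1 z : G z <= 1 by rewrite ge_min lexx.
have G0 := triangular_gauge_ge0.
have [x1|x1] := leP 1 (D x).
  by apply: le_trans (G1 _) _; rewrite [G x]min_l// lerDl.
have [y1|y1] := leP 1 (D y).
  by apply: le_trans (G1 _) _; rewrite [G y]min_l// lerDr.
rewrite [G x]min_r ?(ltW x1)// [G y]min_r ?(ltW y1)// ge_min; apply/orP; right.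
apply: D_le => [|i]; first by rewrite addr_ge0.
apply: le_trans (lerD (le_D x i) (le_D y i)).
apply: le_trans (powR_subadd (alpha01 i) _ _) => //.
by apply: ge0_ler_powR; rewrite ?nnegrE ?addr_ge0// ltW.
Qed.

Let small_bound (c : 'I_n -> R) : (forall i, 0 < c i) ->
  exists2 h : R, 0 < h <= 1 & forall i, h <= c i.
Proof.
move=> c0; have [h h0 hc] := exists_pos_lbound (index_enum 'I_n) c0.
exists (Num.min 1 h); first by rewrite lt_min ltr01 h0 ge_min lexx.
by move=> i; rewrite ge_min hc ?orbT// mem_index_enum.
Qed.

Lemma triangular_gauge_small e : 0 < e ->
  exists2 h, 0 < h & forall z, G z < h -> forall i, `|z i 0| < e.
Proof.
move=> e0; pose c := e / mxsum (invmx V).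
have c0 : 0 < c by rewrite divr_gt0// mxsum_gt0.
have [|h /andP[h0 h1] hc] := @small_bound (fun i => c `^ (b / a i)).
  by move=> i; exact: powR_gt0.
exists h => // z; rewrite gt_min ltNge h1/= => Dz i.
have -> : e = mxsum (invmx V) * c by rewrite mulrC divfK// gt_eqF// mxsum_gt0.
apply: norm_lt => // j; rewrite leNgt; apply/negP => cN.
have := lt_le_trans (le_lt_trans (le_D z j) Dz) (hc j); apply/negP;
  rewrite -leNgt /=.
by apply: ge0_ler_powR; rewrite ?nnegrE ?(ltW c0)// ltW.
Qed.

Lemma triangular_gauge_cont e : 0 < e ->
  exists2 h, 0 < h & forall z : 'cV[R]_n, (forall i, `|z i 0| < h) -> G z < e.
Proof.
move=> e0; pose e2 := e / 2; have e20 : 0 < e2 by rewrite divr_gt0.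
have [|h /andP[h0 h1] hc] := @small_bound (fun i => e2 `^ (b / a i)^-1).
  by move=> i; exact: powR_gt0.
exists (h / mxsum V) => [|z zh]; first by rewrite divr_gt0// mxsum_gt0.
rewrite gt_min; apply/orP; right; apply: (@le_lt_trans _ _ e2); last first.
  by rewrite ltr_pdivrMr// ltr_pMr// ltr1n.
apply: D_le => [|i]; first exact: ltW.
rewrite -[leRHS]powRr1 ?(ltW e20)// -(@mulVf _ (b / a i)) ?gt_eqF// [leRHS]powRrM.
apply: ge0_ler_powR; rewrite ?nnegrE ?powR_ge0 ?(ltW (alpha_gt0 i))//.
apply: le_trans (hc i); have -> : h = mxsum V * (h / mxsum V).
  by rewrite mulrC divfK// gt_eqF// mxsum_gt0.
by apply/ltW/N_lt => [|j]; [rewrite divr_gt0// mxsum_gt0|exact/ltW/zh].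
Qed.

(** Row [i] of [T] involves only [j <= i], where [a j >= a i] by the sorting; if [M = D z <= 1],
    these coordinates are all at most [M^(a_i / b)]. The row sum is at most [e^(a_i)], and the power
    [b / a i] turns [e^(a_i) M^(a_i / b)] into [e^b M]. *)
Lemma triangular_gauge_Lip z : G (A *m z) <= expR b * G z.
Proof.
have b1 : 1 <= expR b by rewrite -[leLHS]expR0 ler_expR ltW.
have [_ _ E Tt _] := YJT.
have [Dz|Dz] := leP 1 (D z).
  by rewrite [G z]min_l// mulr1 (le_trans _ b1)// ge_min lexx.
rewrite [G z]min_r ?(ltW Dz)// ge_min; apply/orP; right.
set M := D z in Dz *; have M0 : 0 <= M by exact: D_ge0.
apply: D_le => [|i]; first by rewrite mulr_ge0// expR_ge0.
have NM (j : 'I_n) : (j <= i)%N -> N z j <= M `^ (a i / b).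
  move=> ji; apply: (@le_trans _ _ (M `^ (a j / b))).
    rewrite -[leLHS]powRr1// -(@mulfV _ (b / a j)) ?gt_eqF// [leLHS]powRrM
      invf_div.
    by apply: ge0_ler_powR; rewrite ?nnegrE ?powR_ge0 ?le_D// ltW// divr_gt0.
  have [->|MN0] := eqVneq M 0; first by rewrite !powR0 ?gt_eqF// divr_gt0.
  have {}M0 : 0 < M by rewrite lt_neqAle eq_sym MN0.
  by apply: ger_powR; rewrite ?M0 ?(ltW Dz)// ler_pM2r ?invr_gt0// a_anti.
have : N (A *m z) i <= expR (a i) * M `^ (a i / b).
  rewrite /N map_mxM mulmxA E -mulmxA.
  apply: le_trans (normc_mulmx _ _ _) _.
  apply: (@le_trans _ _ ((normc (T i i) + \sum_(j < n | (j < i)%N) normc (T i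
    j)) *
      M `^ (a i / b))).
    rewrite (bigD1 i)//= mulrDl lerD//;
      first by rewrite ler_wpM2l ?normc_ge0// NM.
    rewrite mulr_suml (bigID (fun j : 'I_n => (j < i)%N))/=.
    rewrite [X in _ + X]big1 ?addr0 => [|j].
      rewrite (eq_bigl (fun j : 'I_n => (j < i)%N)) => [|j].
        by apply: ler_sum => j ji; rewrite ler_wpM2l ?normc_ge0// NM// ltnW.
      by rewrite andbC; case: ltnP => //= ji; rewrite -val_eqE/= ltn_eqF.
    rewrite -leqNgt => /andP[ji ij]; move/is_trig_mxP : Tt => ->.
      by rewrite normc0 mul0r.
    by rewrite ltn_neqAle eq_sym ij andbT.
  rewrite ler_wpM2r ?powR_ge0//; apply: le_trans (expR_a i).
  by rewrite lerD2l.
move=> /(ge0_ler_powR (ltW (alpha_gt0 i)))/le_trans; apply;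
  rewrite ?nnegrE ?mulr_ge0 ?powR_ge0 ?expR_ge0//.
rewrite powRM ?expR_ge0 ?powR_ge0// -powRrM -[b / a i]invf_div mulfV; last first.
  by rewrite gt_eqF// divr_gt0.
by rewrite powRr1// -expRM invf_div [a i * _]mulrC divfK// gt_eqF.
Qed.

(** Boxes are cut in the real coordinates [Y x], so that each index counts once; boxes in the
    complex coordinates would count real and imaginary parts separately. *)
Lemma triangular_HD_le : (HD (torus_dist G) <=
  (\sum_i (ln (Num.max 1 (normc (T i i))) + b) / b)%:E)%E.
Proof.
have [_ _ _ _ [J0 _]] := YJT.
pose K := mxsum J; have K0 : 0 < K by exact: mxsum_gt0.
pose B := mxsum (toC Y); have B0 : 0 < B by exact: mxsum_gt0.
pose C := 2 * B * K + 1.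
have C0 : 0 < C by rewrite ltr_wpDl// !mulr_ge0// ltW.
apply: (@HD_le_box _ _ _ (C ^+ n)); last 1 first.
- move=> r /andP[r0 r1].
  (* Dividing by [K] absorbs the row sums of [J]. *)
  pose s j := r `^ (a j / b) / K.
  have s0 j : 0 < s j by rewrite divr_gt0// powR_gt0.
  pose M j := (Num.truncn (2 * B / s j)).+1.
  pose u (x : 'cV[R]_n) j := ((Y *m x) j 0 + B) / s j.
  pose Q := [set x : 'cV[R]_n | forall i, 0 <= x i 0 <= 1].
  have uP x j : Q x -> 0 <= u x j <= 2 * B / s j.
    move=> Qx; have : `|(Y *m x) j 0| < B.
      rewrite -normc_real -[B]mulr1.
      have -> : ((Y *m x) j 0)%:C%C = (toC Y *m toC x) j 0 by rewrite -map_mxM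
        [in RHS]mxE.
      apply: normc_mulmx_lt => // i; rewrite mxE normc_real.
      by have /andP[x0 x1] := Qx i; rewrite ger0_norm.
    rewrite ltr_norml => /andP[h1 h2].
    rewrite divr_ge0 ?(ltW (s0 j))//= ?ler_pM2r ?invr_gt0//; lra.
  pose I : finType := {dffun forall j : 'I_n, 'I_(M j)}.
  pose cell (k : I) : set (torus R n) := [set torus_proj x | x in
    [set x | Q x /\ forall j, Num.truncn (u x j) = k j]].
  exists I, cell; split.
  + move=> t; have [x <-] := torus_projK t.
    pose x' : 'cV[R]_n := \col_i (x i 0 - (Num.floor (x i 0))%:~R).
    have Qx' : Q x'.
      move=> i; rewrite mxE.
      by have := real_floor_itv (num_real (x i 0)); rewrite intrD; lra.
    exists [ffun j => inord (Num.truncn (u x' j))] => /=.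
    exists x'; last first.
      apply/torus_projP => i; rewrite !mxE addrAC subrr sub0r rpredN.
      exact: intr_int.
    split=> // j; rewrite ffunE inordK// ltnS le_truncn//.
    by have /andP[] := uP _ j Qx'.
  + move=> k _ _ [x [Qx xk] <-] [y [Qy yk] <-].
    apply: le_trans (torus_dist_le triangular_gauge_ge0 _ _) _.
    rewrite ge_min; apply/orP; right; apply: D_le => [|i]; first exact: ltW.
    have : N (x - y) i <= r `^ (a i / b).
      rewrite /N /V -mulmxA -map_mxM; apply: le_trans (normc_mulmx _ _ _) _.
      apply: (@le_trans _ _ (\sum_j normc (J i j) * (r `^ (a i / b) / K))).
        apply: ler_sum => j _; have [->|Jij] := eqVneq (J i j) 0.
          by rewrite normc0 !mul0r.
        rewrite ler_wpM2l ?normc_ge0//.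
        (* [J] mixes only indices of equal modulus, hence of equal exponent [a]. *)
        have -> : r `^ (a i / b) / K = s j by rewrite /s /a (J0 _ _ Jij).
        rewrite mxE normc_real mulmxBr.
        have -> : (Y *m x - Y *m y) j 0 = (u x j - u y j) * s j.
          by rewrite -mulrBl divfK ?gt_eqF// !mxE; ring.
        rewrite normrM (gtr0_norm (s0 j)) ler_piMl ?(ltW (s0 j))//.
        have /andP[ux _] := uP _ j Qx; have /andP[uy _] := uP _ j Qy.
        have := truncn_itv ux; have := truncn_itv uy.
        by rewrite xk yk -natr1 ler_norml; lra.
      rewrite -mulr_suml mulrA ler_pdivrMr// mulrC ler_wpM2l ?powR_ge0//.
      exact/ltW/row_sum_lt_mxsum.
    move=> /(ge0_ler_powR (ltW (alpha_gt0 i)))/le_trans; apply;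
      rewrite ?nnegrE ?powR_ge0//.
    rewrite -powRrM -[b / a i]invf_div mulfV ?powRr1 ?(ltW r0)//.
    by rewrite gt_eqF// divr_gt0.
  + have -> : r `^ (\sum_i a i / b) = \prod_i r `^ (a i / b).
      apply: (big_morph (fun z => r `^ z)) => [x y|]; last by rewrite powRr0.
      by rewrite powRD// (gt_eqF r0) implybT.
    rewrite card_dep_ffun foldrE big_image/= natr_prod -big_split/=.
    rewrite -[X in _ <= C ^+ X]card_ord -prodr_const.
    (* Each factor [M j * r ^ (a j / b)] is at most [2 * B * K + 1]. *)
    apply: ler_prod => j _; rewrite card_ord mulr_ge0 ?powR_ge0//=.
    rewrite /M -natr1 mulrDl mul1r lerD//;
      last by rewrite -(powRr0 r) ger_powR ?r0// divr_ge0 ?ltW.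
    have p0 : 0 < r `^ (a j / b) by exact: powR_gt0.
    rewrite -ler_pdivlMr//; apply: (@le_trans _ _ (2 * B / s j)).
      by have /andP[] := truncn_itv (divr_ge0 (mulr_ge0 (ler0n _ 2) (ltW B0))
        (ltW (s0 j))).
    by rewrite /s invf_div mulrA.
- apply: sumr_ge0 => i _; exact: (divr_ge0 (ltW (a_gt0 i)) (ltW b0)).
- by rewrite exprn_gt0.
Qed.

End triangular_metric.

(** * Lower bound for the entropy of a toral endomorphism *)

Section complex_parts.
Variable R : rcfType.

Lemma Re_le_normc (z : R[i]) : `|complex.Re z| <= normc z.
Proof.
by case: z => x y /=; rewrite -sqrtr_sqr ler_wsqrtr// lerDl sqr_ge0.
Qed.

Lemma Im_le_normc (z : R[i]) : `|complex.Im z| <= normc z.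
Proof.
by case: z => x y /=; rewrite -sqrtr_sqr ler_wsqrtr// lerDr sqr_ge0.
Qed.

Lemma normc_le_ReIm (z : R[i]) : normc z <= `|complex.Re z| + `|complex.Im z|.
Proof.
rewrite {1}[z]complexE; apply: le_trans (le_normcD _ _) _.
by rewrite normcM normc_real normc_real /= expr0n expr1n add0r sqrtr1 mul1r.
Qed.

Lemma normcX (z : R[i]) m : normc (z ^+ m) = normc z ^+ m.
Proof. by elim: m => [|m IH]; rewrite ?expr0 ?normc1// !exprS normcM IH. Qed.

End complex_parts.

Lemma iter_mulmxB (R : pzRingType) n (A : 'M[R]_n) k (x y : 'cV[R]_n) :
  iter k (mulmx A) (x - y) = iter k (mulmx A) x - iter k (mulmx A) y.
Proof. by elim: k => //= k ->; rewrite mulmxBr. Qed.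

Lemma trig_iter_mulmx (R : pzRingType) n (T : 'M[R]_n) (v : 'cV[R]_n) (i : 'I_n)
  k :
  is_trig_mx T -> (forall j : 'I_n, (j < i)%N -> v j 0 = 0) ->
  iter k (mulmx T) v i 0 = T i i ^+ k * v i 0.
Proof.
move=> /is_trig_mxP Tt v0.
suff : iter k (mulmx T) v i 0 = T i i ^+ k * v i 0 /\
    forall j : 'I_n, (j < i)%N -> iter k (mulmx T) v j 0 = 0 by case.
elim: k => [|k [IH IHj]]; first by rewrite expr0 mul1r.
split=> /= [|j ji]; rewrite mxE.
  rewrite (bigD1 i)//= IH exprS mulrA big1 ?addr0// => j ji.
  have [lt_ji|] := ltnP j i; first by rewrite IHj// mulr0.
  rewrite leq_eqVlt => /predU1P[/val_inj ij|ij]; first by rewrite ij eqxx in ji.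
  by rewrite Tt// mul0r.
rewrite big1// => l _; have [lt_li|il] := ltnP l i; first by rewrite IHj// mulr0.
by rewrite Tt ?mul0r// (leq_trans ji).
Qed.

(** * Covers by boxes and separated grids *)

Section torus_entropy.
Variables (R : realType) (n : nat) (A : 'M[int]_n) (f : torus R n -> torus R n).
Hypothesis fA : forall x, f (torus_proj x) = torus_proj (map_mx intr A *m x).
Local Notation proj := (@torus_proj R n).
Local Notation toC := (map_mx (real_complex R)).
Let AR : 'M[R]_n := map_mx intr A.

Definition torus_box (e : R) (x : 'cV[R]_n) : set (torus R n) :=
  [set proj y | y in [set y : 'cV[R]_n | forall i, `|x i 0 - y i 0| < e]].

Lemma open_cover_torus_box (e : R) : 0 < e -> open_cover (range (torus_box e)).
Proof.
move=> e0; split=> [_ [x _ <-]|]; last first.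
  apply/seteqP; split=> // t _; have [x <-] := torus_projK t.
  exists (torus_box e x); first by exists x.
  by exists x => // i; rewrite subrr normr0.
apply/torus_openE => y [y' /= xy' /torus_projP yy'].
have [|h h0 hP] := exists_pos_lbound (e := fun i => e - `|x i 0 - y' i 0|)
    (index_enum 'I_n).
  by move=> i; rewrite subr_gt0.
exists h => // z yz; exists (z + (y' - y)) => [i|]; last first.
  by apply/torus_projP => i; rewrite !mxE addrAC subrr add0r; exact: yy'.
rewrite !mxE; have := hP i (mem_index_enum _); rewrite lerBrDr => /lt_le_trans;
  apply.
have -> : x i 0 - (z i 0 + (y' i 0 - y i 0)) =
  (y i 0 - z i 0) + (x i 0 - y' i 0) by ring.
by apply: le_lt_trans (ler_normD _ _) _; rewrite ltrD2r.
Qed.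

Lemma iter_torus_linear k x : iter k f (proj x) = proj (iter k (mulmx AR) x).
Proof. by elim: k => //= k ->; rewrite fA. Qed.

(* As long as the iterates stay close on the torus, they stay close in the
   universal cover, because one step cannot jump to another lattice point. *)
Lemma join_torus_box_close (e : R) m B (x y : 'cV[R]_n) :
  0 < e -> (mxsum (toC AR) + 1) * e <= 1 ->
  iterated_join f (range (torus_box (e / 2))) m.+1 B ->
  B (proj x) -> B (proj y) -> (forall i, `|x i 0 - y i 0| < e) ->
  forall i, `|iter m (mulmx AR) (x - y) i 0| < e.
Proof.
move=> e0 Ae [U UP <-] Bx By xy.
suff : forall k, (k <= m)%N -> forall i, `|iter k (mulmx AR) (x - y) i 0| < e.
  exact.
elim=> [_ i|k IH km i]; first by rewrite /= !mxE.
have Ux : U k.+1 (iter k.+1 f (proj x)) := Bx k.+1 km.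
have Uy : U k.+1 (iter k.+1 f (proj y)) := By k.+1 km.
rewrite !iter_torus_linear in Ux Uy; have [c _ Uc] := UP k.+1.
rewrite -Uc in Ux Uy; move: Ux Uy.
move=> [x' /= cx' /torus_projP xx'] [y' /= cy' /torus_projP yy'].
rewrite -!iterS in xx' yy' *.
rewrite iter_mulmxB; set X := iter _ _ x in xx' *; set Z := iter _ _ y in yy' *.
have XZ : `|(X - Z) i 0| < mxsum (toC AR) * e.
  rewrite /X /Z -iter_mulmxB iterS -normc_real.
  have -> : ((AR *m iter k (mulmx AR) (x - y)) i 0)%:C%C =
     (toC AR *m toC (iter k (mulmx AR) (x - y))) i 0.
    by rewrite -map_mxM [in RHS]mxE.
  apply: normc_mulmx_lt => // j; rewrite mxE normc_real; apply/ltW/IH.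
  exact: ltnW.
have xy' : `|x' i 0 - y' i 0| < e.
  rewrite [e]splitr; have := cy' i; have := cx' i; rewrite !ltr_norml; lra.
suff <- : x' i 0 - y' i 0 = (X - Z) i 0 by [].
(* This integer is smaller than [(mxsum (toC AR) + 1) * e <= 1] in modulus. *)
apply/eqP; rewrite -subr_eq0; apply/eqP/int_num_lt1_eq0.
  have -> : x' i 0 - y' i 0 - (X - Z) i 0 =
    (x' i 0 - X i 0) - (y' i 0 - Z i 0) by rewrite !mxE; ring.
  by rewrite rpredB.
apply: lt_le_trans Ae; apply: le_lt_trans (ler_normB _ _) _.
by rewrite mulrDl mul1r addrC ltrD.
Qed.

Variables (Y : 'M[R]_n) (J T : 'M[R[i]]_n).
Hypothesis YJT : real_triangular AR Y J T.
Let V := J *m toC Y.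

Let V_unit : V \in unitmx.
Proof. by have [Yu Ju _ _ _] := YJT; rewrite unitmx_mul Ju map_unitmx. Qed.

Let iter_V m (z : 'cV[R[i]]_n) :
  V *m iter m (mulmx (toC AR)) z = iter m (mulmx T) (V *m z).
Proof.
have [_ _ E _ _] := YJT.
by elim: m => //= m IH; rewrite mulmxA E -mulmxA -/V IH.
Qed.

(** A vector of triangular coordinates need not come from a real vector: its preimage under [V] is
    split into two real vectors, each of which projects to the torus. *)
Let re (w : 'cV[R[i]]_n) : 'cV[R]_n := map_mx (@complex.Re R) (invmx V *m w).
Let im (w : 'cV[R[i]]_n) : 'cV[R]_n := map_mx (@complex.Im R) (invmx V *m w).

Let iter_toC m (z : 'cV[R]_n) :
  iter m (mulmx (toC AR)) (toC z) = toC (iter m (mulmx AR) z).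
Proof. by elim: m => //= m ->; rewrite map_mxM. Qed.

Let iter_T_lt (e : R) m (v : 'cV[R[i]]_n) : 0 < e ->
  (forall i, `|iter m (mulmx AR) (re v) i 0| < e) ->
  (forall i, `|iter m (mulmx AR) (im v) i 0| < e) ->
  forall i, normc (iter m (mulmx T) v i 0) < mxsum V * (2 * e).
Proof.
move=> e0 Re Ie i; rewrite -[v in iter m _ v](mulKVmx V_unit) -iter_V.
apply: normc_mulmx_lt => [|j]; first by rewrite mulr_gt0.
have -> : iter m (mulmx (toC AR)) (invmx V *m v) =
   toC (iter m (mulmx AR) (re v)) + 'i%C *: toC (iter m (mulmx AR) (im v)).
  rewrite [in LHS](map_mx_ReIm (invmx V *m v)) -!iter_toC -/(re v) -/(im v).
  elim: m {Re Ie} => //= m ->.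
  by rewrite mulmxDr -scalemxAr.
apply: le_trans (normc_le_ReIm _) _; rewrite !mxE /=.
rewrite !(mul0r, mulr0, mul1r, subr0, addr0, add0r, sub0r, oppr0).
by have := Re j; have := Ie j; lra.
Qed.

Let re_lt (e : R) (w : 'cV[R[i]]_n) i : 0 < e ->
  (forall j, normc (w j 0) <= e / mxsum (invmx V)) -> `|re w i 0| < e.
Proof.
move=> e0 we; rewrite mxE; apply: le_lt_trans (Re_le_normc _) _.
have -> : e = mxsum (invmx V) * (e / mxsum (invmx V)).
  by rewrite mulrC divfK// gt_eqF// mxsum_gt0.
by apply: normc_mulmx_lt => //; rewrite divr_gt0// mxsum_gt0.
Qed.

Let im_lt (e : R) (w : 'cV[R[i]]_n) i : 0 < e ->
  (forall j, normc (w j 0) <= e / mxsum (invmx V)) -> `|im w i 0| < e.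
Proof.
move=> e0 we; rewrite mxE; apply: le_lt_trans (Im_le_normc _) _.
have -> : e = mxsum (invmx V) * (e / mxsum (invmx V)).
  by rewrite mulrC divfK// gt_eqF// mxsum_gt0.
by apply: normc_mulmx_lt => //; rewrite divr_gt0// mxsum_gt0.
Qed.

Let reB w w' : re (w - w') = re w - re w'.
Proof. by rewrite /re mulmxBr; apply/matrixP => i j; rewrite !mxE raddfB. Qed.

Let imB w w' : im (w - w') = im w - im w'.
Proof. by rewrite /im mulmxBr; apply/matrixP => i j; rewrite !mxE raddfB. Qed.

(* Two grids, one for the real and one for the imaginary part of each
   triangular coordinate: the first coordinate in which two grid points differ
   gets expanded by [normc (T i i) ^+ m]. *)
Lemma card_cover_ge (e : R) : 0 < e -> (mxsum (toC AR) + 1) * e <= 1 ->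
  exists2 kappa, 0 < kappa & forall m F,
    finite_subcover (iterated_join f (range (torus_box (e / 2))) m.+1) F ->
    \prod_i (kappa * Num.max 1 (normc (T i i)) ^+ m) <= #|` F|%:R.
Proof.
move=> e0 Ae; have [_ _ _ Tt _] := YJT.
have e20 : 0 < e / 2 by rewrite divr_gt0.
pose c1 := mxsum V * (2 * e); have c10 : 0 < c1 by rewrite !mulr_gt0// mxsum_gt0.
pose c0 := (e / 2) / mxsum (invmx V).
have c00 : 0 < c0 by rewrite divr_gt0// mxsum_gt0.
(* The bound [c0 / (2 * c1)] keeps the grid in the region of size [c0]; the bound 1 handles the
   indices with [normc (T i i) <= 1], for which [M i >= 1] is enough. *)
pose kappa := Num.min 1 (c0 / (2 * c1)).
have kappa0 : 0 < kappa by rewrite lt_min ltr01 divr_gt0// mulr_gt0.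
have kappac : 2 * (kappa * c1) <= c0.
  have c20 : 0 < 2 * c1 by exact: mulr_gt0.
  by rewrite mulrCA -ler_pdivlMr// ge_min lexx orbT.
exists kappa => // m F FV.
pose rho i := normc (T i i) ^+ m.
have rho0 i : 0 <= rho i by rewrite exprn_ge0// normc_ge0.
pose M i := (Num.truncn (kappa * rho i)).+1.
pose I : finType := {dffun forall i : 'I_n, 'I_(M i)}.
(* The spacing that [m] iterations expand to [c1]. If [rho i = 0], then [g i = 0] by convention and
   [M i = 1]. *)
pose g i := c1 / rho i.
have g0 i : 0 <= g i by rewrite divr_ge0// ltW.
pose w (pq : I * I) : 'cV[R[i]]_n :=
  \col_i ((g i * (pq.1 i)%:R) +i* (g i * (pq.2 i)%:R))%C.
have gp (p : I) i : g i * (p i)%:R <= kappa * c1.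
  have : (p i)%:R <= kappa * rho i.
    have := ltn_ord (p i); rewrite ltnS => pM.
    have /andP[tr _] := truncn_itv (mulr_ge0 (ltW kappa0) (rho0 i)).
    by apply: le_trans tr; rewrite ler_nat.
  move=> /(ler_wpM2l (g0 i))/le_trans; apply.
  have [->|r0] := eqVneq (rho i) 0; first by rewrite !mulr0 mulr_ge0 ?ltW.
  by rewrite mulrCA /g divfK.
have wc0 pq i : normc (w pq i 0) <= c0.
  apply: le_trans (normc_le_ReIm _) _; rewrite mxE /=.
  have gge (k : nat) : 0 <= g i * k%:R by exact: mulr_ge0.
  rewrite !ger0_norm//; apply: le_trans kappac.
  by rewrite mulr_natl mulr2n lerD.
have wclose (h : 'cV[R[i]]_n -> 'cV[R]_n) pq pq' :
    (forall w w', h (w - w') = h w - h w') ->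
    (forall (w : 'cV[R[i]]_n) i, (forall j, normc (w j 0) <= c0) -> `|h w i 0| <
      e / 2) ->
    forall i, `|h (w pq) i 0 - h (w pq') i 0| < e.
  move=> _ h_lt i; apply: le_lt_trans (ler_normB _ _) _.
  by rewrite [e]splitr ltrD// h_lt.
have FX x : exists B : F, val B x.
  have [_ FX] := FV; have : [set: torus R n] x by [].
  by rewrite -FX => -[B BF Bx]; exists [` BF ]%fset.
(* A complex grid point is sent to two members of [F], one for each of its real points. *)
have /choice[phi phiP] : forall pq, exists BB : F * F,
    val BB.1 (proj (re (w pq))) /\ val BB.2 (proj (im (w pq))).
  by move=> pq; have [B1 ?] := FX (proj (re (w pq)));
    have [B2 ?] := FX (proj (im (w pq))); exists (B1, B2).
have phi_inj : injective phi.
  move=> pq pq' E; have [h1 h2] := phiP pq; have [h1' h2'] := phiP pq'.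
  rewrite -E in h1' h2'.
  pose v := w pq - w pq'.
  have vT i : normc (iter m (mulmx T) v i 0) < c1.
    apply: iter_T_lt => // {}i.
      rewrite reB; apply: (join_torus_box_close e0 Ae _ h1 h1').
        by apply: FV.1; exact: valP.
      by apply: wclose => // ? ? ?; exact: re_lt.
    rewrite imB; apply: (join_torus_box_close e0 Ae _ h2 h2').
      by apply: FV.1; exact: valP.
    by apply: wclose => // ? ? ?; exact: im_lt.
  suff eq_pq (i : 'I_n) : pq.1 i = pq'.1 i /\ pq.2 i = pq'.2 i.
    case: pq pq' eq_pq {h1 h2 h1' h2' E v vT} => [p q] [p' q'] /= eq_pq.
    by congr pair; apply/ffunP => i; case: (eq_pq i).
  (* Once the earlier coordinates agree, [T i i ^+ m] acts on the [i]-th one, where a difference of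
     one grid step would already reach [c1]. *)
  have [k] := ubnP (val i); elim: k i => // k IH i; rewrite ltnS => ik.
  have v0 (j : 'I_n) : (j < i)%N -> v j 0 = 0.
    move=> ji; have [E1 E2] := IH j (leq_trans ji ik).
    by rewrite !mxE E1 E2 subrr.
  have := vT i; rewrite (trig_iter_mulmx _ Tt v0) normcM normcX -/(rho i).
  have [r0 _|r0 vi] := eqVneq (rho i) 0.
    have M1 : M i = 1%N by rewrite /M r0 mulr0 truncn0.
    have ord_0 (x : 'I_(M i)) : x = 0%N :> nat.
      by apply/eqP; rewrite -leqn0 -ltnS -[X in (_ < X)%N]M1 ltn_ord.
    have ord_eq (x y : 'I_(M i)) : x = y by apply: val_inj; rewrite /= !ord_0.
    by split; exact: ord_eq.
  have rgt0 : 0 < rho i by rewrite lt_neqAle eq_sym r0 rho0.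
  have far (x y : 'I_(M i)) : `|g i * x%:R - g i * y%:R| <= normc (v i 0) -> x =
    y.
    move=> xy; apply: contraTeq vi => xNy; rewrite -leNgt.
    apply: le_trans (ler_wpM2l (ltW rgt0) xy).
    rewrite -mulrBr normrM ger0_norm// mulrA [rho i * _]mulrC divfK//.
    rewrite ler_peMr ?(ltW c10)// !pmulrn -intrB -intr_norm ler1z.
    by rewrite -gtz0_ge1 normr_gt0 subr_eq0.
  split; apply: far.
    by apply: le_trans (Re_le_normc _); rewrite !mxE.
  by apply: le_trans (Im_le_normc _); rewrite !mxE.
(* [I * I] injects into [F * F]; the squares cancel. *)
have : (#|I| <= #|` F|)%N.
  rewrite -leq_sqr cardfE -!mulnn -!card_prod.
  exact: leq_card phi_inj.
rewrite -(ler_nat R); apply: le_trans.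
rewrite card_dep_ffun foldrE big_image/= natr_prod.
apply: ler_prod => i _; rewrite card_ord.
rewrite mulr_ge0 ?exprn_ge0 ?le_max ?ler01 ?(ltW kappa0)//=.
have [Ti|Ti] := leP (normc (T i i)) 1.
  by rewrite expr1n mulr1 /M (@le_trans _ _ 1)// ?ge_min ?lexx// ler1n.
by rewrite ltW// truncnS_gt.
Qed.

Lemma sum_log_le_entropy :
  ((\sum_i ln (Num.max 1 (normc (T i i))))%:E <= topological_entropy R f)%E.
Proof.
pose e : R := (mxsum (toC AR) + 1)^-1.
have s0 : 0 < mxsum (toC AR) + 1 by rewrite addr_gt0// mxsum_gt0.
have e0 : 0 < e by rewrite invr_gt0.
have Ae : (mxsum (toC AR) + 1) * e <= 1 by rewrite /e mulfV// gt_eqF.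
have [kappa kappa0 FP] := card_cover_ge e0 Ae.
set lam := \sum_i _.
have Uoc := open_cover_torus_box (divr_gt0 e0 (ltr0n R 2)).
apply: (@le_trans _ _ (cover_entropy R f (range (torus_box (e / 2)))));
  last first.
  by apply: ereal_sup_ubound; exists (range (torus_box (e / 2))).
have [F0 F0U] := open_cover_finite_subcover (@torus_cover_compact R n) Uoc.
(* [expR (- lam)] compensates the shift between the join of length [m.+1] and the exponent [m] of
   the moduli. *)
apply: (@cover_entropy_ge _ _ f _ (proj 0) F0 F0U (kappa ^+ n * expR (- lam))).
  by rewrite mulr_gt0 ?exprn_gt0 ?expR_gt0.
move=> [//|m] F _ FV; apply: le_trans (FP m F FV).
rewrite big_split/= prodr_const card_ord -mulrA ler_wpM2l ?exprn_ge0 ?(ltW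
  kappa0)//.
rewrite -expRD -natr1 mulrDr mulr1 addrCA addNr addr0 expRM_natr.
rewrite prodrXl lerXn2r ?nnegrE ?expR_ge0 ?prodr_ge0//.
  by move=> i _; rewrite le_max ler01.
rewrite /lam expR_sum; apply: ler_prod => i _.
by rewrite expR_ge0 lnK ?lexx// posrE lt_max ltr01.
Qed.

End torus_entropy.

(** * Metrics that nearly realize the entropy *)

Lemma torus_metric_small (R : realType) (n : nat) (f : torus R n -> torus R n)
    (b : R) : torus_linear f -> 0 < b ->
  exists2 d : torus R n -> torus R n -> R, compatible_metric d &
    mul_infty (HD d) (logp (Lip d f)) \is a fin_num /\
    (mul_infty (HD d) (logp (Lip d f)) <=
       topological_entropy R f + (n%:R * b)%:E)%E.
Proof.
move=> [A fA] b0; pose AR : 'M[R]_n := map_mx intr A.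
have eb : 0 < expR b - 1 by rewrite subr_gt0 expR_gt1.
have [Y [J [T [YJT Tsmall]]]] := real_triangular_small AR eb.
pose G := triangular_gauge b Y J T.
have dc : compatible_metric (torus_dist G).
  apply: torus_dist_compatible.
  - exact: triangular_gauge_ge0.
  - exact: triangular_gaugeN.
  - exact: triangular_gaugeD.
  - exact: (triangular_gauge_small b0 YJT).
  - exact: triangular_gauge_cont.
exists (torus_dist G) => //.
have Lf : (Lip (torus_dist G) f <= (expR b)%:E)%E.
  apply: ge_ereal_sup => _ [->|[[t u] /= tu <-]];
    first by rewrite lee_fin expR_ge0.
  rewrite lee_fin ler_pdivrMr//; apply: (torus_dist_linear _ fA).
  - exact: triangular_gauge_ge0.
  - exact: expR_gt0.
  - exact: triangular_gauge_Lip.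
have lf : (logp (Lip (torus_dist G) f) <= b%:E)%E.
  rewrite /logp ge_max lee_fin (ltW b0) andbT -[b]expRK -lne_EFin ?expR_gt0//.
  rewrite lee_lne ?in_itv/= ?leey ?andbT ?lee_fin ?expR_ge0//.
  exact: Lip_ge0.
have hd : (HD (torus_dist G) <= (\sum_i (ln (Num.max 1 (normc (T i i))) + b) /
  b)%:E)%E.
  exact: (triangular_HD_le b0 YJT).
have hN : HD (torus_dist G) \is a fin_num.
  by rewrite ge0_fin_numE ?HD_ge0// (le_lt_trans hd) ?ltry.
have lN : logp (Lip (torus_dist G) f) \is a fin_num.
  by rewrite ge0_fin_numE ?logp_ge0// (le_lt_trans lf) ?ltry.
rewrite /mul_infty !lt_eqF ?ltey_eq ?hN ?lN//=; split; first exact: fin_numM.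
apply: (@le_trans _ _ ((\sum_i (ln (Num.max 1 (normc (T i i))) + b) / b)%:E *
  b%:E)%E).
  by apply: lee_pmul => //; [exact: HD_ge0|exact: logp_ge0].
(* The denominator [b] of the dimension cancels against the logarithm [b] of the Lipschitz
   constant. *)
rewrite -EFinM -mulr_suml divfK ?gt_eqF// big_split/= sumr_const card_ord
  mulr_natl EFinD.
by apply: leeD => //; exact: (sum_log_le_entropy fA YJT).
Qed.

Theorem theorem3 (R : realType) (n : nat) (hn : (1 <= n)%N)
    (f : torus R n -> torus R n) (hf : torus_linear f) :
  HausLip R f = topological_entropy R f /\
  forall eps : R, 0 < eps ->
    exists2 d : torus R n -> torus R n -> R, compatible_metric d &
      (mul_infty (HD d) (logp (Lip d f)) < topological_entropy R f + eps%:E)%E.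
Proof.
have nR : 0 < n%:R :> R by rewrite ltr0n.
(* The parameter [b = e / n] turns the error [n * b] into [e]. *)
have small e : 0 < e -> exists2 d : torus R n -> torus R n -> R,
  compatible_metric d &
    mul_infty (HD d) (logp (Lip d f)) \is a fin_num /\
    (mul_infty (HD d) (logp (Lip d f)) <= topological_entropy R f + e%:E)%E.
  by move=> e0; have := torus_metric_small hf (divr_gt0 e0 nR);
    rewrite mulrC divfK ?gt_eqF.
have h_le d : compatible_metric d ->
    (topological_entropy R f <= mul_infty (HD d) (logp (Lip d f)))%E.
  by move=> dc; exact: topological_entropy_le_mul_infty (torus_proj 0) dc
    (@torus_cover_compact R n) f.
split.
  apply/eqP; rewrite eq_le; apply/andP; split.
    apply/lee_addgt0Pr => e /small[d dc [_]]; apply: le_trans.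
    by apply: ereal_inf_lbound; exists d.
  by apply: le_ereal_inf_tmp => _ [d /h_le + <-].
move=> e e0; have [d dc [dN dh]] := small (e / 2) (divr_gt0 e0 (ltr0n R 2)).
(* Caught between finite bounds, the entropy is finite, so that adding [e / 2] or [e] to it gives a
   strict inequality. *)
have hN : topological_entropy R f \is a fin_num.
  move: dN dh (h_le d dc) => /fineK <-.
  by case: (topological_entropy R f).
exists d => //; apply: le_lt_trans dh _.
by rewrite lteD2lE// lte_fin ltr_pdivrMr// ltr_pMr// ltr1n.
Qed.
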